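(* Fix an integer $r\ge 1$ and consider the Reed–Muller codes $\mathrm{RM}(r,m)$ of length $n=2^m$ and minimum distance $d=2^{m-r}$ as $m\to\infty$. The recursive decoding algorithm $\Psi_r^m$ has complexity $O(n)$ and, on this sequence of codes, has decoding threshold $\delta=n/2$ with residual $$\varepsilon_r=\left(\frac{2r\ln m}{d}\right)^{1/2^{r+1}}.$$ That is: (i) $\Psi_r^m$ correctly decodes all but a vanishing (as $m\to\infty$) fraction of the error patterns of Hamming weight at most $\frac n2(1-\varepsilon_r)$; and (ii) $\Psi_r^m$ fails to decode a non-vanishing fraction of the error patterns of weight at most $n/2$.
   Context: $\mathrm{RM}(r,m)$ is the binary code of all evaluation vectors $(f(x))_{x\in\mathbb F_2^m}$ of $m$-variate Boolean polynomials $f$ of degree $\le r$, with positions $x=(x_1,\dots,x_m)$ ordered lexicographically ($x_1$ most significant). Binary symbols $a$ are mapped to $(-1)^a$, so codewords lie in $\{\pm1\}^n$ and mod-2 addition becomes componentwise multiplication. Writing $f=f'(x_2,\dots,x_m)+x_1f''(x_2,\dots,x_m)$ shows each codeword of $\mathrm{RM}(r,m)$ is $(\mathbf u,\mathbf u\mathbf v)$ with $\mathbf u\in\mathrm{RM}(r,m-1)$, $\mathbf v\in\mathrm{RM}(r-1,m-1)$ (componentwise product). Minimum-distance (MD) decoding of a code $C$ applied to $\mathbf z\in\mathbb R^l$ outputs a codeword $\mathbf c\in C$ maximizing the inner product $(\mathbf c,\mathbf z)$ (for one-symbol decisions, sign$(0)$ is $\pm1$ with probability $1/2$ each). Step $\Psi_{\rm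 rec}$: given $\mathbf y=(\mathbf y',\mathbf y'')\in\mathbb R^n$ (two halves), compute $\mathbf y^v=\mathbf y'\mathbf y''$ (componentwise), decode it to $\hat{\mathbf v}\in\mathrm{RM}(r-1,m-1)$; then compute $\mathbf y^u=(\mathbf y'+\mathbf y''\hat{\mathbf v})/2$, decode it to $\hat{\mathbf u}\in\mathrm{RM}(r,m-1)$; output $(\hat{\mathbf u},\hat{\mathbf u}\hat{\mathbf v})$. Algorithm $\Psi_r^m$: if $0<r<m$ perform $\Psi_{\rm rec}$ using $\Psi_{r-1}^{m-1}$ and $\Psi_r^{m-1}$ as the two sub-decoders; if $r=0$ (repetition code) or $r=m$ (full space), perform MD decoding. The received word is $\mathbf y\in\{\pm1\}^n$. Threshold definition: for a sequence of codes of lengths $n_i\to\infty$, a decoding algorithm has threshold sequence $\delta_i$ and residual sequence $\epsilon_i\to0$ if it correctly decodes all but a vanishing fraction of error patterns of weight $\le\delta_i(1-\epsilon_i)$ and fails to decode a non-vanishing fraction of error patterns of weight $\le\delta_i$. *)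

(* Defs.v *)
From Stdlib Require Import Bool Reals List.
Import ListNotations.
Open Scope R_scope.

(* All x = (x_1,...,x_m) in F_2^m, lexicographic order, x_1 most significant
   (false = 0 < true = 1). *)
Fixpoint cube (m : nat) : list (list bool) :=
  match m with
  | O => [[]]
  | S m' => map (cons false) (cube m') ++ map (cons true) (cube m')
  end.

Definition count_true (s : list bool) : nat := length (filter (fun b => b) s).

(* monomial with support s (s_i = true iff x_i occurs) evaluated at x *)
Fixpoint monom (s x : list bool) : bool :=
  match s, x with
  | b :: s', a :: x' => (negb b || a) && monom s' x'
  | _, _ => true
  end.

Definition monomials (r m : nat) : list (list bool) :=
  filter (fun s => Nat.leb (count_true s) r) (cube m).

Definition eval_poly (r m : nat) (a : list bool -> bool) (x : list bool) : bool :=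
  fold_right xorb false (map (fun s => a s && monom s x) (monomials r m)).

Definition sgn (b : bool) : R := if b then -1 else 1.

Definition RM_word (r m : nat) (a : list bool -> bool) : list R :=
  map (fun x => sgn (eval_poly r m a x)) (cube m).

Definition in_RM (r m : nat) (c : list R) : Prop := exists a, c = RM_word r m a.

Definition Dist (A : Type) := list (R * A).
Definition dret {A} (x : A) : Dist A := [(1, x)].
Definition dbind {A B} (d : Dist A) (f : A -> Dist B) : Dist B :=
  flat_map (fun px => map (fun qy => (fst px * fst qy, snd qy)) (f (snd px))) d.
Definition coin {A} (x y : A) : Dist A := [(1/2, x); (1/2, y)].

Definition prob_eq (d : Dist (list R)) (c : list R) : R :=
  fold_right Rplus 0
    (map (fun px => if list_eq_dec Req_EM_T (snd px) c then fst px else 0) d).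

Fixpoint zipw (f : R -> R -> R) (a b : list R) : list R :=
  match a, b with
  | x :: a', y :: b' => f x y :: zipw f a' b'
  | _, _ => []
  end.

Definition sign_dec (z : R) : Dist R :=
  if Rlt_dec 0 z then dret 1
  else if Rlt_dec z 0 then dret (-1) else coin 1 (-1).

Fixpoint dmapM (f : R -> Dist R) (l : list R) : Dist (list R) :=
  match l with
  | [] => dret []
  | z :: l' => dbind (f z) (fun s => dbind (dmapM f l') (fun t => dret (s :: t)))
  end.

(* MD decoding of the repetition code RM(0,m) = {all +1, all -1} *)
Definition md_rep (z : list R) : Dist (list R) :=
  dbind (sign_dec (fold_right Rplus 0 z)) (fun s => dret (repeat s (length z))).

(* MD decoding of the full space RM(m,m) = {+-1}^n: symbolwise *)
Definition md_full (z : list R) : Dist (list R) := dmapM sign_dec z.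

Fixpoint psi (r m : nat) (y : list R) {struct m} : Dist (list R) :=
  match r with
  | O => md_rep y
  | S r' =>
    match m with
    | O => md_full y
    | S m' =>
      if Nat.leb m r then md_full y
      else
        let y1 := firstn (2 ^ m') y in
        let y2 := skipn (2 ^ m') y in
        dbind (psi r' m' (zipw Rmult y1 y2)) (fun v =>
        dbind (psi r m' (zipw (fun a b => (a + b) / 2) y1 (zipw Rmult y2 v))) (fun u =>
        dret (u ++ zipw Rmult u v)))
    end
  end.

(* arithmetic operation count of Psi_r^m (unit cost per real operation / sign):
   MD on length n: n operations; Psi_rec: n/2 products for y^v, 3n/2 operations
   for y^u, n/2 products for the output. *)
Fixpoint psi_cost (r m : nat) : nat :=
  match r with
  | O => 2 ^ m
  | S r' =>
    match m with
    | O => 1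
    | S m' => if Nat.leb m r then 2 ^ m
              else psi_cost r' m' + psi_cost r m' + 5 * 2 ^ m'
    end
  end.

Definition received (c : list R) (e : list bool) : list R :=
  zipw Rmult c (map sgn e).

Definition patterns_upto (m : nat) (w : R) : list (list bool) :=
  filter (fun e => if Rle_dec (INR (count_true e)) w then true else false)
         (cube (2 ^ m)).

Definition fail_frac (r m : nat) (c : list R) (w : R) : R :=
  fold_right Rplus 0
    (map (fun e => 1 - prob_eq (psi r m (received c e)) c) (patterns_upto m w))
  / INR (length (patterns_upto m w)).

Definition eps_r (r m : nat) : R :=
  Rpower (2 * INR r * ln (INR m) / 2 ^ (m - r)) (1 / 2 ^ (r + 1)).

(* Main.v *)
Require Import Defs.
From Stdlib Require Import Reals List.
From Stdlib Require Import Bool Lra Lia Arith Permutation.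
Import ListNotations.
Open Scope R_scope.

(* (i) The decoder commutes with multiplication by codewords, so assume the
   all-one codeword was sent. It can only fail at a leaf of the recursion, where a sum
   S of products and averages of received symbols must be <= 0; by Chebyshev
   this costs at most E (S / E S - 1)^2, and these costs are summed over all
   leaves. For independent symbols of mean e the relative variance x of a symbol
   evolves by x -> x^2 + 2x (product) and x -> x/2 (average), starting from
   x = e^-2 - 1; the all-product leaf contributes e^(-2^(r+1)) / d, that is
   1 / (2 r ln m) at e = eps_r, and each averaging before the last product halves
   this at least, so the leaves together cost O(1 / ln m). A uniform pattern of
   weight t does not have independent symbols, but S and S^2 are nonnegative
   combinations of characters of bounded degree, whose means on the shell of
   weight t are normalized Krawtchouk values; these lie between (1 - eta) e^k and
   e^k with e = 1 - 2t/n and eta = O(1 / (n e^2)).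

   (ii) Summed over all of the cube, the success probability of a codeword c is
   the same as that of three other codewords, hence at most 2^n / 4, whereas at
   least half of all patterns have weight <= n/2. *)

(** As long as all earlier leaves were decoded correctly, every leaf input is a fixed polynomial in
    the received symbols, so no conditioning survives in the union bound. Chebyshev enters
    pointwise, as a quadratic in [S] that is at least 1 when [S <= 0]; hence only means of
    characters are needed and no concentration on a shell. In this quadratic the square takes the
    upper estimate of the mean and the negative linear term the lower one, so passing to independent
    symbols costs just [2 eta] per leaf. The obstacle is that the all-product leaf alone already has
    a bound of order [1 / ln m], while the number of leaves grows polynomially in [m]: a uniform
    bound per leaf would diverge. The leaf costs are therefore summed inside the recursion as a
    polynomial in the relative variance, whose top coefficient must not depend on [m]. Lower powers
    may carry a factor [(m + 1)^r], because [eps_r ^ (-2)] is exponential in [m] up to polynomial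
    factors and one missing power of it pays for that factor. In (ii), two competing words would
    only give the bound [2^n / 2], the very size guaranteed for the ball; four leave a margin. *)

Local Notation "a ** b" := (zipw Rmult a b) (at level 40, left associativity).

(** * Finite sums and finitely supported distributions *)

Definition rsum {A} (f : A -> R) (l : list A) : R :=
  fold_right Rplus 0 (map f l).

Lemma rsum_app {A} (f : A -> R) l1 l2 : rsum f (l1 ++ l2) = rsum f l1 + rsum f l2.
Proof.
unfold rsum; induction l1 as [|x l1 IH]; simpl; [lra|rewrite IH; lra].
Qed.

Lemma rsum_map {A B} (f : B -> R) (g : A -> B) l :
  rsum f (map g l) = rsum (fun x => f (g x)) l.
Proof. unfold rsum; rewrite map_map; reflexivity. Qed.

Lemma rsum_le {A} (f g : A -> R) l :
  (forall x, In x l -> f x <= g x) -> rsum f l <= rsum g l.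
Proof.
unfold rsum; induction l as [|x l IH]; simpl; intros H; [lra|].
apply Rplus_le_compat; auto.
Qed.

Lemma rsum_ext {A} (f g : A -> R) l :
  (forall x, In x l -> f x = g x) -> rsum f l = rsum g l.
Proof.
intros H; apply Rle_antisym; apply rsum_le; intros x Hx;
  rewrite (H x Hx); apply Rle_refl.
Qed.

Lemma rsum_plus {A} (f g : A -> R) l :
  rsum (fun x => f x + g x) l = rsum f l + rsum g l.
Proof.
unfold rsum; induction l as [|x l IH]; simpl; [lra|rewrite IH; lra].
Qed.

Lemma rsum_scal {A} (a : R) (f : A -> R) l :
  rsum (fun x => a * f x) l = a * rsum f l.
Proof.
unfold rsum; induction l as [|x l IH]; simpl; [lra|rewrite IH; lra].
Qed.

Lemma rsum_const {A} (a : R) (l : list A) : rsum (fun _ => a) l = a * INR (length l).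
Proof.
induction l as [|x l IH]; [unfold rsum; simpl; lra|].
change (length (x :: l)) with (S (length l)); rewrite S_INR.
unfold rsum in *; simpl; rewrite IH; lra.
Qed.

Lemma rsum_zero {A} (l : list A) : rsum (fun _ => 0) l = 0.
Proof. rewrite rsum_const; lra. Qed.

Lemma rsum_swap {A B} (f : A -> B -> R) l1 l2 :
  rsum (fun x => rsum (f x) l2) l1 = rsum (fun y => rsum (fun x => f x y) l1) l2.
Proof.
induction l1 as [|x l1 IH].
- unfold rsum at 1; simpl; symmetry; apply rsum_zero.
- change (rsum (f x) l2 + rsum (fun x => rsum (f x) l2) l1 =
    rsum (fun y => f x y + rsum (fun x => f x y) l1) l2).
  rewrite IH, rsum_plus; reflexivity.
Qed.

Lemma rsum_filter {A} (p : A -> bool) (f : A -> R) l :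
  rsum f (filter p l) = rsum (fun x => (if p x then 1 else 0) * f x) l.
Proof.
unfold rsum; induction l as [|x l IH]; simpl; [reflexivity|].
destruct (p x); simpl; rewrite IH; lra.
Qed.

Definition ex {A} (d : Dist A) (f : A -> R) : R :=
  rsum (fun px => fst px * f (snd px)) d.

Lemma ex_dret {A} (x : A) f : ex (dret x) f = f x.
Proof. unfold ex, rsum, dret; simpl; lra. Qed.

Lemma ex_coin {A} (x y : A) f : ex (coin x y) f = (f x + f y) / 2.
Proof. unfold ex, rsum, coin; simpl; lra. Qed.

Lemma ex_dbind {A B} (d : Dist A) (k : A -> Dist B) f :
  ex (dbind d k) f = ex d (fun x => ex (k x) f).
Proof.
unfold ex, dbind; induction d as [|[p x] d IH]; simpl; [reflexivity|].
rewrite rsum_app, rsum_map, IH; simpl.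
change (rsum (fun qy => p * fst qy * f (snd qy)) (k x) +
  rsum (fun px => fst px * rsum (fun py => fst py * f (snd py)) (k (snd px))) d =
  p * rsum (fun py => fst py * f (snd py)) (k x) +
  rsum (fun px => fst px * rsum (fun py => fst py * f (snd py)) (k (snd px))) d).
rewrite <- rsum_scal; f_equal.
apply rsum_ext; intros; ring.
Qed.

Lemma ex_plus {A} (d : Dist A) f g : ex d (fun x => f x + g x) = ex d f + ex d g.
Proof.
unfold ex; rewrite <- rsum_plus; apply rsum_ext; intros; ring.
Qed.

Lemma ex_scal {A} (d : Dist A) a f : ex d (fun x => a * f x) = a * ex d f.
Proof.
unfold ex; rewrite <- rsum_scal; apply rsum_ext; intros; ring.
Qed.

Lemma ex_ext {A} (d : Dist A) f g : (forall x, f x = g x) -> ex d f = ex d g.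
Proof. intros H; apply rsum_ext; intros; rewrite H; reflexivity. Qed.

Lemma ex_swap {A B} (d : Dist A) (d' : Dist B) (f : A -> B -> R) :
  ex d (fun x => ex d' (f x)) = ex d' (fun y => ex d (fun x => f x y)).
Proof.
unfold ex.
transitivity (rsum (fun px => rsum (fun qy =>
  fst px * (fst qy * f (snd px) (snd qy))) d') d).
- apply rsum_ext; intros; rewrite rsum_scal; reflexivity.
- rewrite rsum_swap; apply rsum_ext; intros; rewrite <- rsum_scal.
  apply rsum_ext; intros; ring.
Qed.

(** Nonnegativity of the weights travels together with the support, so that a single hypothesis
    yields monotonicity of [ex], whose weights are otherwise arbitrary reals. *)
Definition supp {A} (P : A -> Prop) (d : Dist A) : Prop :=
  forall px, In px d -> 0 <= fst px /\ P (snd px).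

Lemma supp_dret {A} (P : A -> Prop) x : P x -> supp P (dret x).
Proof. intros H px [<-|[]]; simpl; split; [lra|exact H]. Qed.

Lemma supp_dbind {A B} (P : A -> Prop) (P' : B -> Prop) d k :
  supp P d -> (forall x, P x -> supp P' (k x)) -> supp P' (dbind d k).
Proof.
intros Hd Hk py Hy; unfold dbind in Hy.
apply in_flat_map in Hy as [px [Hx Hy]].
apply in_map_iff in Hy as [qy [<- Hy]].
destruct (Hd _ Hx) as [Hp HP]; destruct (Hk _ HP _ Hy) as [Hq HP']; simpl.
split; [apply Rmult_le_pos; assumption|assumption].
Qed.

Lemma supp_ex_le {A} (P : A -> Prop) d f g :
  supp P d -> (forall x, P x -> f x <= g x) -> ex d f <= ex d g.
Proof.
intros Hd H; apply rsum_le; intros px Hx; destruct (Hd _ Hx) as [Hp HP].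
apply Rmult_le_compat_l; auto.
Qed.

Lemma supp_ex_ext {A} (P : A -> Prop) d f g :
  supp P d -> (forall x, P x -> f x = g x) -> ex d f = ex d g.
Proof.
intros Hd H; apply rsum_ext; intros px Hx; destruct (Hd _ Hx) as [_ HP].
rewrite (H _ HP); reflexivity.
Qed.

(** * Componentwise products of vectors *)

Lemma zipw_length f a b : length a = length b -> length (zipw f a b) = length a.
Proof.
revert b; induction a as [|x a IH]; intros [|y b] H; simpl in *; auto; try lia.
Qed.

Lemma zipw_app f a1 a2 b1 b2 : length a1 = length b1 ->
  zipw f (a1 ++ a2) (b1 ++ b2) = zipw f a1 b1 ++ zipw f a2 b2.
Proof.
revert b1; induction a1 as [|x a1 IH]; intros [|y b1] H; simpl in *;
  try discriminate; [reflexivity|rewrite IH; auto].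
Qed.

Lemma had_comm a b : a ** b = b ** a.
Proof.
revert b; induction a as [|x a IH]; intros [|y b]; simpl; auto.
rewrite IH, Rmult_comm; reflexivity.
Qed.

Lemma had_assoc a b c : a ** (b ** c) = a ** b ** c.
Proof.
revert b c; induction a as [|x a IH]; intros [|y b] [|z c]; simpl; auto.
rewrite IH, Rmult_assoc; reflexivity.
Qed.

Lemma had_ones n y : length y = n -> repeat 1 n ** y = y.
Proof.
revert n; induction y as [|x y IH]; intros [|n] H; simpl in *; auto; try discriminate.
rewrite Rmult_1_l, IH; auto.
Qed.

Lemma had_repeat a n y : length y = n -> repeat a n ** y = map (Rmult a) y.
Proof.
revert n; induction y as [|x y IH]; intros [|n] H; simpl in *; auto; try discriminate.
rewrite IH; auto.
Qed.

Definition pm (x : R) : Prop := x = 1 \/ x = -1.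

Lemma had_square g n : length g = n -> Forall pm g -> g ** g = repeat 1 n.
Proof.
intros <- H; induction H as [|x g Hx H IH]; simpl; auto.
rewrite IH; f_equal; destruct Hx; subst; lra.
Qed.

Lemma had_cancel g y : length g = length y -> Forall pm g -> g ** (g ** y) = y.
Proof.
intros Hl H; rewrite had_assoc, (had_square g _ Hl H); apply had_ones; reflexivity.
Qed.

Lemma had_pm g h : Forall pm g -> Forall pm h -> Forall pm (g ** h).
Proof.
intros H; revert h; induction H as [|x g Hx H IH]; intros [|y h] Hh; simpl;
  try constructor.
- inversion Hh; subst; destruct Hx, H2; subst; [left|right|right|left]; lra.
- inversion Hh; subst; auto.
Qed.

(** * Equivariance of the decoder under codewords *)

(* Recursion along the same case tree as [psi]: repetition codes, full spaces,
   and the (u, uv) step. *)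
Fixpoint rm_rec {A : Type} (rep full : nat -> A) (step : nat -> A -> A -> A)
    (r m : nat) {struct m} : A :=
  match r with
  | O => rep m
  | S r' =>
    match m with
    | O => full m
    | S m' => if Nat.leb m r then full m
              else step m' (rm_rec rep full step r' m') (rm_rec rep full step r m')
    end
  end.

Section RmRec.
Context {A : Type} (rep full : nat -> A) (step : nat -> A -> A -> A).

Lemma rm_rec_rep m : rm_rec rep full step 0 m = rep m.
Proof. destruct m; reflexivity. Qed.

Lemma rm_rec_full r m : (1 <= r)%nat -> (m <= r)%nat -> rm_rec rep full step r m = full m.
Proof.
intros H1 H2; destruct r as [|r]; [lia|]; destruct m as [|m]; [reflexivity|].
cbn [rm_rec]; rewrite (proj2 (Nat.leb_le _ _) H2); reflexivity.
Qed.

Lemma rm_rec_step r m : (r < m)%nat ->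
  rm_rec rep full step (S r) (S m) =
  step m (rm_rec rep full step r m) (rm_rec rep full step (S r) m).
Proof.
intros H; cbn [rm_rec]; rewrite (proj2 (Nat.leb_gt _ _)); [reflexivity|lia].
Qed.

End RmRec.

Lemma rm_ind (P : nat -> nat -> Prop) :
  (forall m, P 0%nat m) ->
  (forall r m, (1 <= r)%nat -> (m <= r)%nat -> P r m) ->
  (forall r m, (r < m)%nat -> P r m -> P (S r) m -> P (S r) (S m)) ->
  forall r m, P r m.
Proof.
intros H0 H1 H2 r m; revert r; induction m as [|m IH]; intros [|r]; auto.
- apply H1; lia.
- destruct (Nat.lt_ge_cases r m); [apply H2|apply H1]; auto; lia.
Qed.

Lemma psi_rep m y : psi 0 m y = md_rep y.
Proof. destruct m; reflexivity. Qed.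

Lemma psi_full r m y : (1 <= r)%nat -> (m <= r)%nat -> psi r m y = md_full y.
Proof.
intros H1 H2; destruct r as [|r]; [lia|]; destruct m as [|m]; [reflexivity|].
cbn [psi]; rewrite (proj2 (Nat.leb_le _ _) H2); reflexivity.
Qed.

Definition avg : list R -> list R -> list R := zipw (fun a b => (a + b) / 2).

Lemma avg_had g a b : avg (g ** a) (g ** b) = g ** avg a b.
Proof.
unfold avg; revert a b; induction g as [|x g IH]; intros [|y a] [|z b]; simpl; auto.
rewrite IH; f_equal; field.
Qed.

Lemma psi_step r m y : (r < m)%nat ->
  psi (S r) (S m) y =
  let y1 := firstn (2 ^ m) y in
  let y2 := skipn (2 ^ m) y in
  dbind (psi r m (y1 ** y2)) (fun v =>
  dbind (psi (S r) m (avg y1 (y2 ** v))) (fun u => dret (u ++ u ** v))).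
Proof.
intros H; cbn [psi]; rewrite (proj2 (Nat.leb_gt _ _)); [reflexivity|lia].
Qed.

Lemma halves (y : list R) m : length y = (2 ^ S m)%nat ->
  length (firstn (2 ^ m) y) = (2 ^ m)%nat /\ length (skipn (2 ^ m) y) = (2 ^ m)%nat.
Proof.
intros H; rewrite length_firstn, length_skipn, H.
change (2 ^ S m)%nat with (2 * 2 ^ m)%nat; lia.
Qed.

Lemma sign_dec_supp z : supp (fun _ => True) (sign_dec z).
Proof.
unfold sign_dec; destruct Rlt_dec; [|destruct Rlt_dec].
1,2: apply supp_dret; exact I.
intros px [<-|[<-|[]]]; simpl; split; auto; lra.
Qed.

Lemma dmapM_supp l : supp (fun c => length c = length l) (dmapM sign_dec l).
Proof.
induction l as [|z l IH]; simpl; [apply supp_dret; reflexivity|].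
apply supp_dbind with (1 := sign_dec_supp z); intros s _.
apply supp_dbind with (1 := IH); intros t Ht; apply supp_dret; simpl; auto.
Qed.

Lemma psi_supp r m : forall y, length y = (2 ^ m)%nat ->
  supp (fun c => length c = (2 ^ m)%nat) (psi r m y).
Proof.
revert r m; apply (rm_ind (fun r m => forall y, length y = (2 ^ m)%nat ->
  supp (fun c => length c = (2 ^ m)%nat) (psi r m y))).
- intros m y Hy; rewrite psi_rep.
  apply supp_dbind with (1 := sign_dec_supp _); intros s _.
  apply supp_dret; rewrite repeat_length; exact Hy.
- intros r m H1 H2 y Hy; rewrite psi_full by assumption; rewrite <- Hy.
  apply dmapM_supp.
- intros r m H IHv IHu y Hy; rewrite psi_step by assumption; cbv zeta.
  destruct (halves _ _ Hy) as [H1 H2].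
  apply supp_dbind with (fun c => length c = (2 ^ m)%nat).
  { apply IHv; rewrite zipw_length; congruence. }
  intros v Hv; apply supp_dbind with (fun c => length c = (2 ^ m)%nat).
  { apply IHu; unfold avg; rewrite zipw_length; auto.
    rewrite zipw_length; congruence. }
  intros u Hu; apply supp_dret.
  rewrite length_app, zipw_length by congruence.
  rewrite Hu; change (2 ^ S m)%nat with (2 * 2 ^ m)%nat; lia.
Qed.

Lemma sign_dec_mass z : ex (sign_dec z) (fun _ => 1) = 1.
Proof.
unfold sign_dec; destruct Rlt_dec; [|destruct Rlt_dec];
  rewrite ?ex_dret, ?ex_coin; lra.
Qed.

Lemma dbind_mass {A B} (d : Dist A) (k : A -> Dist B) :
  ex d (fun _ => 1) = 1 -> (forall x, ex (k x) (fun _ => 1) = 1) ->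
  ex (dbind d k) (fun _ => 1) = 1.
Proof.
intros Hd Hk; rewrite ex_dbind, (ex_ext d _ (fun _ => 1)); auto.
Qed.

Lemma dret_mass {A} (x : A) : ex (dret x) (fun _ => 1) = 1.
Proof. exact (ex_dret x (fun _ => 1)). Qed.

Lemma dmapM_mass l : ex (dmapM sign_dec l) (fun _ => 1) = 1.
Proof.
induction l as [|z l IH]; simpl; [apply dret_mass|].
apply dbind_mass; [apply sign_dec_mass|intros s].
apply dbind_mass; [exact IH|intros t; apply dret_mass].
Qed.

Lemma psi_mass r m : forall y, ex (psi r m y) (fun _ => 1) = 1.
Proof.
revert r m; apply (rm_ind (fun r m => forall y, ex (psi r m y) (fun _ => 1) = 1)).
- intros m y; rewrite psi_rep; apply dbind_mass; [apply sign_dec_mass|].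
  intros; apply dret_mass.
- intros r m H1 H2 y; rewrite psi_full by assumption; apply dmapM_mass.
- intros r m H IHv IHu y; rewrite psi_step by assumption; cbv zeta.
  apply dbind_mass; [apply IHv|intros v].
  apply dbind_mass; [apply IHu|intros u; apply dret_mass].
Qed.

(** The [(u, uv)] description of codewords along the case tree of [psi]. Everything below is proved
    for these words; only the inclusion of the evaluation vectors among them, [in_RM_rm_word], links
    them to the code. *)
Definition rm_word : nat -> nat -> list R -> Prop :=
  rm_rec (fun m c => c = repeat 1 (2 ^ m) \/ c = repeat (-1) (2 ^ m))
         (fun m c => length c = (2 ^ m)%nat /\ Forall pm c)
         (fun m Pv Pu c => exists u v, Pu u /\ Pv v /\ c = u ++ u ** v).

Lemma rm_word_pm r m : forall c, rm_word r m c -> length c = (2 ^ m)%nat /\ Forall pm c.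
Proof.
revert r m; apply (rm_ind (fun r m => forall c, rm_word r m c ->
  length c = (2 ^ m)%nat /\ Forall pm c)); unfold rm_word.
- intros m c; rewrite rm_rec_rep; intros [-> | ->]; rewrite repeat_length; split; auto;
  apply Forall_forall; intros x Hx; apply repeat_spec in Hx; subst; unfold pm; auto.
- intros r m H1 H2 c; rewrite rm_rec_full by assumption; auto.
- intros r m H IHv IHu c; rewrite rm_rec_step by assumption.
  intros (u & v & Hu & Hv & ->).
  destruct (IHu _ Hu) as [Lu Pu]; destruct (IHv _ Hv) as [Lv Pv]; split.
  + rewrite length_app, zipw_length by congruence.
    change (2 ^ S m)%nat with (2 * 2 ^ m)%nat; lia.
  + apply Forall_app; split; [|apply had_pm]; assumption.
Qed.

(** The tie at [z = 0] is where the fairness of the coin matters: its law is invariant under a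
    change of sign. *)
Lemma sign_dec_pm g z f : pm g ->
  ex (sign_dec (g * z)) f = ex (sign_dec z) (fun s => f (g * s)).
Proof.
unfold sign_dec; intros [-> | ->]; repeat destruct Rlt_dec; try lra;
  rewrite ?ex_dret, ?ex_coin;
  replace (1 * 1) with 1 by ring; replace (1 * -1) with (-1) by ring;
  replace (-1 * 1) with (-1) by ring; replace (-1 * -1) with 1 by ring; lra.
Qed.

Lemma map_repeat_R (f : R -> R) x n : map f (repeat x n) = repeat (f x) n.
Proof. induction n; simpl; congruence. Qed.

Lemma sum_repeat_had g y :
  fold_right Rplus 0 (repeat g (length y) ** y) = g * fold_right Rplus 0 y.
Proof.
rewrite had_repeat by reflexivity.
induction y as [|x y IH]; simpl; [ring|rewrite IH; ring].
Qed.

(** A codeword [(gu, gu gv)] multiplies the first sub-decoder's input by [gv], since [gu] squares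
    away. Once its output has become [gv v], the factor [gv] squares away as well and the second
    input is multiplied by [gu]. Equality of laws is expressed through all test functions [f]. *)
Lemma psi_equivariant r m : forall g y f, rm_word r m g -> length y = (2 ^ m)%nat ->
  ex (psi r m (g ** y)) f = ex (psi r m y) (fun c => f (g ** c)).
Proof.
revert r m; apply (rm_ind (fun r m => forall g y f, rm_word r m g ->
  length y = (2 ^ m)%nat ->
  ex (psi r m (g ** y)) f = ex (psi r m y) (fun c => f (g ** c)))); unfold rm_word.
- intros m g y f; rewrite rm_rec_rep, !psi_rep; intros Hg Hy.
  assert (exists a, pm a /\ g = repeat a (2 ^ m)) as (a & Ha & ->).
  { destruct Hg; eexists; split; [|eassumption| |eassumption]; unfold pm; auto. }
  unfold md_rep; rewrite !ex_dbind, <- Hy, sum_repeat_had, sign_dec_pm by assumption.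
  apply ex_ext; intros s; rewrite !ex_dret.
  rewrite zipw_length, repeat_length by (apply repeat_length).
  rewrite had_repeat, map_repeat_R by (apply repeat_length); reflexivity.
- intros r m H1 H2 g y f; rewrite rm_rec_full, !psi_full by assumption.
  intros [Lg Pg] Hy; unfold md_full.
  assert (L : length g = length y) by congruence; clear - Pg L.
  revert y f L; induction Pg as [|a g Ha Pg IH]; intros [|x y] f L; try discriminate; simpl.
  { rewrite !ex_dret; reflexivity. }
  rewrite !ex_dbind, sign_dec_pm by assumption; apply ex_ext; intros s.
  rewrite !ex_dbind, IH by (simpl in L; lia); apply ex_ext; intros t.
  rewrite !ex_dret; reflexivity.
- intros r m H IHv IHu g y f; rewrite rm_rec_step by assumption.
  intros (gu & gv & Hu & Hv & ->) Hy; rewrite !psi_step by assumption; cbv zeta.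
  destruct (rm_word_pm _ _ _ Hu) as [Lu Pu]; destruct (rm_word_pm _ _ _ Hv) as [Lv Pv].
  destruct (halves _ _ Hy) as [L1 L2].
  set (y1 := firstn (2 ^ m) y) in *; set (y2 := skipn (2 ^ m) y) in *.
  assert (Ey : (gu ++ gu ** gv) ** y = (gu ** y1) ++ (gu ** gv ** y2)).
  { rewrite <- (firstn_skipn (2 ^ m) y) at 1; apply zipw_app; fold y1; congruence. }
  assert (L1' : length (gu ** y1) = (2 ^ m)%nat) by (rewrite zipw_length; congruence).
  assert (F1 : firstn (2 ^ m) ((gu ** y1) ++ (gu ** gv ** y2)) = gu ** y1).
  { rewrite <- L1', firstn_app, Nat.sub_diag, firstn_all, firstn_O, app_nil_r; reflexivity. }
  assert (F2 : skipn (2 ^ m) ((gu ** y1) ++ (gu ** gv ** y2)) = gu ** gv ** y2).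
  { rewrite <- L1', skipn_app, Nat.sub_diag, skipn_all; reflexivity. }
  rewrite Ey, F1, F2.
  assert (Ev : (gu ** y1) ** (gu ** gv ** y2) = gv ** (y1 ** y2)).
  { rewrite (had_comm gu y1), <- (had_assoc gu gv y2), <- (had_assoc y1 gu).
    rewrite had_cancel by (rewrite ?zipw_length; congruence).
    rewrite !had_assoc, (had_comm y1 gv); reflexivity. }
  rewrite Ev, !ex_dbind, IHv by (auto; rewrite zipw_length; congruence).
  apply supp_ex_ext with (P := fun c => length c = (2 ^ m)%nat).
  { apply psi_supp; rewrite zipw_length; congruence. }
  intros v Hv'; rewrite !ex_dbind.
  assert (Eu : avg (gu ** y1) (gu ** gv ** y2 ** (gv ** v)) = gu ** avg y1 (y2 ** v)).
  { replace (gu ** gv ** y2 ** (gv ** v)) with (gu ** (y2 ** v)).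
    - apply avg_had.
    - rewrite <- (had_assoc gu gv y2), <- (had_assoc gu).
      f_equal; rewrite <- (had_assoc gv y2), (had_assoc y2 gv v), (had_comm y2 gv).
      rewrite <- (had_assoc gv y2 v), had_cancel; auto.
      rewrite zipw_length; congruence. }
  assert (Lu' : length (avg y1 (y2 ** v)) = (2 ^ m)%nat).
  { unfold avg; rewrite zipw_length; rewrite ?zipw_length; congruence. }
  rewrite Eu, IHu by auto.
  apply supp_ex_ext with (P := fun c => length c = (2 ^ m)%nat).
  { apply psi_supp; exact Lu'. }
  intros u Hu'; rewrite !ex_dret, zipw_app by congruence; do 2 f_equal.
  rewrite !had_assoc; f_equal; rewrite <- !had_assoc; f_equal; apply had_comm.
Qed.

(** * Reed-Muller words and decoding at half the length *)

Lemma cube_length m : length (cube m) = (2 ^ m)%nat.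
Proof.
induction m as [|m IH]; [reflexivity|].
simpl cube; rewrite length_app, !length_map, IH.
change (2 ^ S m)%nat with (2 * 2 ^ m)%nat; lia.
Qed.

Lemma in_cube m s : In s (cube m) <-> length s = m.
Proof.
revert s; induction m as [|m IH]; intros s; simpl.
- split; [intros [<-|[]]; reflexivity|destruct s; auto; discriminate].
- rewrite in_app_iff, !in_map_iff; split.
  + intros [(t & <- & Ht)|(t & <- & Ht)]; apply IH in Ht; simpl; auto.
  + destruct s as [|[] s]; intros H; try discriminate; injection H as H; [right|left];
      exists s; split; auto; apply IH; exact H.
Qed.

(** Monomials split by whether the leading variable occurs; this is the [(u, uv)] decomposition
    before evaluation. *)
Lemma monomials_step r m : monomials (S r) (S m) =
  map (cons false) (monomials (S r) m) ++ map (cons true) (monomials r m).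
Proof.
unfold monomials; simpl cube; rewrite filter_app, !filter_map_swap; reflexivity.
Qed.

Lemma monomials_rep m : monomials 0 m = [repeat false m].
Proof.
unfold monomials; induction m as [|m IH]; [reflexivity|].
simpl cube; rewrite filter_app, !filter_map_swap.
change (map (cons false) (filter (fun s => (count_true s <=? 0)%nat) (cube m)) ++
  map (cons true) (filter (fun s => false) (cube m)) = [repeat false (S m)]).
rewrite IH.
replace (filter (fun _ => false) (cube m)) with (@nil (list bool)); [reflexivity|].
clear; induction (cube m); simpl; auto.
Qed.

Definition xor_sum {A} (f : A -> bool) (l : list A) : bool :=
  fold_right xorb false (map f l).

Lemma xor_sum_app {A} (f : A -> bool) l1 l2 :
  xor_sum f (l1 ++ l2) = xorb (xor_sum f l1) (xor_sum f l2).
Proof.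
unfold xor_sum; induction l1 as [|x l1 IH]; simpl; [destruct fold_right; auto|].
rewrite IH, xorb_assoc; reflexivity.
Qed.

Lemma xor_sum_map {A B} (f : B -> bool) (g : A -> B) l :
  xor_sum f (map g l) = xor_sum (fun x => f (g x)) l.
Proof. unfold xor_sum; rewrite map_map; reflexivity. Qed.

Lemma xor_sum_false {A} (f : A -> bool) l :
  (forall x, f x = false) -> xor_sum f l = false.
Proof. intros H; induction l; unfold xor_sum in *; simpl; auto; rewrite H, IHl; auto. Qed.

Lemma eval_poly_step r m a b x : eval_poly (S r) (S m) a (b :: x) =
  xorb (eval_poly (S r) m (fun s => a (false :: s)) x)
       (b && eval_poly r m (fun s => a (true :: s)) x).
Proof.
unfold eval_poly; rewrite monomials_step.
change (xor_sum (fun s => a s && monom s (b :: x))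
    (map (cons false) (monomials (S r) m) ++ map (cons true) (monomials r m)) =
  xorb (xor_sum (fun s => a (false :: s) && monom s x) (monomials (S r) m))
    (b && xor_sum (fun s => a (true :: s) && monom s x) (monomials r m))).
rewrite xor_sum_app, !xor_sum_map; f_equal; destruct b; [reflexivity|].
apply xor_sum_false; intros s; apply andb_false_r.
Qed.

Lemma sgn_xorb a b : sgn (xorb a b) = sgn a * sgn b.
Proof. destruct a, b; unfold sgn; simpl; lra. Qed.

Lemma sgn_pm b : pm (sgn b).
Proof. destruct b; unfold pm, sgn; auto. Qed.

Lemma zipw_map_same {A} (f : R -> R -> R) (g h : A -> R) l :
  zipw f (map g l) (map h l) = map (fun x => f (g x) (h x)) l.
Proof. induction l; simpl; congruence. Qed.

Lemma in_RM_rm_word r m : forall c, in_RM r m c -> rm_word r m c.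
Proof.
revert r m; apply (rm_ind (fun r m => forall c, in_RM r m c -> rm_word r m c));
  unfold rm_word.
- intros m c [a ->]; rewrite rm_rec_rep; unfold RM_word.
  assert (E : forall x, eval_poly 0 m a x = a (repeat false m)).
  { intros x; unfold eval_poly; rewrite monomials_rep; simpl.
    replace (monom (repeat false m) x) with true.
    - destruct (a (repeat false m)); reflexivity.
    - revert x; induction m as [|m IH]; intros [|b x]; simpl; auto. }
  rewrite (map_ext _ _ (fun x => f_equal sgn (E x))), map_const, cube_length.
  destruct (a (repeat false m)); auto.
- intros r m H1 H2 c [a ->]; rewrite rm_rec_full by assumption.
  unfold RM_word; rewrite length_map, cube_length; split; auto.
  apply Forall_forall; intros x Hx; apply in_map_iff in Hx as [y [<- _]]; apply sgn_pm.
- intros r m H IHv IHu c [a ->]; rewrite rm_rec_step by assumption.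
  exists (RM_word (S r) m (fun s => a (false :: s))),
    (RM_word r m (fun s => a (true :: s))).
  split; [apply IHu; eexists; reflexivity|split; [apply IHv; eexists; reflexivity|]].
  unfold RM_word; simpl cube; rewrite map_app, !map_map, zipw_map_same; f_equal;
    apply map_ext; intros x; rewrite eval_poly_step, sgn_xorb; simpl; auto.
  change (sgn false) with 1; ring.
Qed.

Lemma rm_word_const r m a : pm a -> rm_word r m (repeat a (2 ^ m)).
Proof.
revert a; revert r m; apply (rm_ind (fun r m => forall a, pm a ->
  rm_word r m (repeat a (2 ^ m)))); unfold rm_word.
- intros m a [-> | ->]; rewrite rm_rec_rep; auto.
- intros r m H1 H2 a Ha; rewrite rm_rec_full, repeat_length by assumption; split; auto.
  apply Forall_forall; intros x Hx; apply repeat_spec in Hx; subst; assumption.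
- intros r m H IHv IHu a Ha; rewrite rm_rec_step by assumption.
  exists (repeat a (2 ^ m)), (repeat 1 (2 ^ m)).
  split; [apply IHu; auto|split; [apply IHv; left; auto|]].
  rewrite had_comm, had_ones, <- repeat_app by (apply repeat_length); f_equal.
  change (2 ^ S m)%nat with (2 * 2 ^ m)%nat; lia.
Qed.

(** The words of the affine functions [x_1] and [x_1 + 1], which together with the two constants
    compete with a given output in (ii). *)
Lemma rm_word_halves r m a : (r < m)%nat -> pm a ->
  rm_word (S r) (S m) (repeat a (2 ^ m) ++ repeat (- a) (2 ^ m)).
Proof.
intros H Ha; unfold rm_word; rewrite rm_rec_step by assumption.
exists (repeat a (2 ^ m)), (repeat (-1) (2 ^ m)).
split; [apply rm_word_const; auto|split; [apply rm_word_const; right; auto|]].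
rewrite had_repeat, map_repeat_R by (apply repeat_length).
do 2 f_equal; lra.
Qed.

Definition csum (n : nat) (f : list bool -> R) : R := rsum f (cube n).

Lemma csum_0 f : csum 0 f = f [].
Proof. unfold csum, rsum; simpl; lra. Qed.

Lemma csum_S n f : csum (S n) f =
  csum n (fun e => f (false :: e)) + csum n (fun e => f (true :: e)).
Proof. unfold csum; simpl cube; rewrite rsum_app, !rsum_map; reflexivity. Qed.

Lemma csum_le n f g : (forall e, length e = n -> f e <= g e) -> csum n f <= csum n g.
Proof. intros H; apply rsum_le; intros e He; apply in_cube in He; auto. Qed.

Lemma csum_ext n f g : (forall e, length e = n -> f e = g e) -> csum n f = csum n g.
Proof. intros H; apply rsum_ext; intros e He; apply in_cube in He; auto. Qed.

Lemma INR_pow2 j : INR (2 ^ j) = 2 ^ j.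
Proof. rewrite pow_INR; reflexivity. Qed.

Lemma csum_const n a : csum n (fun _ => a) = a * 2 ^ n.
Proof.
unfold csum; rewrite rsum_const, cube_length, pow_INR; reflexivity.
Qed.

Fixpoint xorl (a b : list bool) : list bool :=
  match a, b with
  | x :: a', y :: b' => xorb x y :: xorl a' b'
  | _, _ => []
  end.

Lemma map_sgn_xorl a b : map sgn (xorl a b) = map sgn a ** map sgn b.
Proof.
revert b; induction a as [|x a IH]; intros [|y b]; simpl; auto.
rewrite sgn_xorb, IH; reflexivity.
Qed.

Lemma csum_translate n s f : length s = n -> csum n (fun e => f (xorl s e)) = csum n f.
Proof.
intros <-; revert f; induction s as [|b s IH]; intros f; simpl length.
- rewrite !csum_0; reflexivity.
- rewrite !csum_S; simpl.
  rewrite (IH (fun e => f (xorb b false :: e))), (IH (fun e => f (xorb b true :: e))).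
  destruct b; simpl; lra.
Qed.

Lemma pm_sgn c : Forall pm c -> exists s, c = map sgn s.
Proof.
intros H; induction H as [|x c Hx H [s ->]]; [exists []; reflexivity|].
destruct Hx; subst; [exists (false :: s)|exists (true :: s)]; reflexivity.
Qed.

Definition eqi (c x : list R) : R := if list_eq_dec Req_EM_T x c then 1 else 0.

Lemma prob_eq_ex d c : prob_eq d c = ex d (eqi c).
Proof.
unfold prob_eq; fold (rsum (fun px => if list_eq_dec Req_EM_T (snd px) c then fst px else 0) d).
apply rsum_ext; intros px _; unfold eqi; destruct list_eq_dec; ring.
Qed.

Lemma eqi_refl c : eqi c c = 1.
Proof. unfold eqi; destruct list_eq_dec; congruence. Qed.

Lemma eqi_neq c x : x <> c -> eqi c x = 0.
Proof. unfold eqi; destruct list_eq_dec; congruence. Qed.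

Lemma eqi_01 c x : 0 <= eqi c x <= 1.
Proof. unfold eqi; destruct list_eq_dec; lra. Qed.

(** The inequality holds for any map [g], injective or not, and is all that comparing success
    probabilities takes. *)
Lemma eqi_image (g : list R -> list R) c x : eqi c x <= eqi (g c) (g x).
Proof.
destruct (list_eq_dec Req_EM_T x c) as [->|H].
- rewrite !eqi_refl; lra.
- rewrite (eqi_neq c x H); apply eqi_01.
Qed.

Lemma psi_prob_01 r m y c : length y = (2 ^ m)%nat ->
  0 <= ex (psi r m y) (eqi c) <= 1.
Proof.
intros Hy; pose proof (psi_supp r m y Hy) as Hs; split.
- rewrite <- (Rmult_0_l (ex (psi r m y) (fun _ => 1))), <- ex_scal.
  apply (supp_ex_le _ _ _ _ Hs); intros x _; pose proof (eqi_01 c x); lra.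
- rewrite <- (psi_mass r m y); apply (supp_ex_le _ _ _ _ Hs); intros x _; apply eqi_01.
Qed.

Lemma psi_prob_translate r m g y c : rm_word r m g -> length y = (2 ^ m)%nat ->
  ex (psi r m y) (eqi c) <= ex (psi r m (g ** y)) (eqi (g ** c)).
Proof.
intros Hg Hy; rewrite psi_equivariant by assumption.
apply (supp_ex_le _ _ _ _ (psi_supp r m y Hy)); intros x _.
apply (eqi_image (zipw Rmult g)).
Qed.

(** Multiplying the received word by [g] turns the output [c] into [g ** c] and merely permutes the
    cube of received words. *)
Lemma csum_psi_translate r m g c : rm_word r m g ->
  csum (2 ^ m) (fun e => ex (psi r m (map sgn e)) (eqi c)) <=
  csum (2 ^ m) (fun e => ex (psi r m (map sgn e)) (eqi (g ** c))).
Proof.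
intros Hg; destruct (rm_word_pm _ _ _ Hg) as [Lg Pg].
destruct (pm_sgn _ Pg) as [s ->]; rewrite length_map in Lg.
rewrite <- (csum_translate _ s (fun e => ex (psi r m (map sgn e)) (eqi (map sgn s ** c))) Lg).
apply csum_le; intros e He; rewrite map_sgn_xorl.
apply psi_prob_translate; auto; rewrite length_map; auto.
Qed.

(* Over all of the cube the four words obtained from c by changing the sign of
   either half are equally likely outputs. *)
Lemma csum_success r m c : (r < m)%nat -> rm_word (S r) (S m) c ->
  csum (2 ^ S m) (fun e => ex (psi (S r) (S m) (map sgn e)) (eqi c)) <= 2 ^ (2 ^ S m) / 4.
Proof.
intros H Hc.
(* By halves: [(1,-1)], [(-1,1)], [(-1,-1)] and [(1,1)]. The last case also catches all [i > 3],
   hence the bounds [i < 4] below. *)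
pose (g i := match i with
  | 0%nat => repeat 1 (2 ^ m) ++ repeat (- 1) (2 ^ m)
  | 1%nat => repeat (-1) (2 ^ m) ++ repeat (- -1) (2 ^ m)
  | 2%nat => repeat (-1) (2 ^ S m)
  | _ => repeat 1 (2 ^ S m) end).
assert (Hg : forall i, rm_word (S r) (S m) (g i)).
{ intros [|[|[|i]]]; simpl g; try apply rm_word_halves; try apply rm_word_const;
    auto; unfold pm; auto. }
set (T c := csum (2 ^ S m) (fun e => ex (psi (S r) (S m) (map sgn e)) (eqi c))).
assert (HT : forall i, T c <= T (g i ** c)) by (intros; apply csum_psi_translate; auto).
assert (Hinj : forall i j, g i ** c = g j ** c -> g i = g j).
{ intros i j E; destruct (rm_word_pm _ _ _ Hc) as [Lc Pc].
  destruct (rm_word_pm _ _ _ (Hg i)) as [Li _].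
  destruct (rm_word_pm _ _ _ (Hg j)) as [Lj _].
  rewrite <- (had_cancel c (g i)), <- (had_cancel c (g j)), !(had_comm c (g _)), E
    by (auto; congruence).
  reflexivity. }
assert (Hd : exists k, (2 ^ m = S k)%nat).
{ exists (2 ^ m - 1)%nat; pose proof (Nat.pow_nonzero 2 m); lia. }
destruct Hd as [k Hk].
assert (Hk2 : (2 ^ S m = S k + S k)%nat) by (change (2 ^ S m)%nat with (2 * 2 ^ m)%nat; lia).
(* Entries [0] and [S k = 2^m], the first of each half, already tell the four words apart. *)
assert (Hn : forall i j, (i < 4)%nat -> (j < 4)%nat -> g i = g j -> i = j).
{ intros i j Hi Hj E.
  assert (E1 : nth 0 (g i) 0 = nth 0 (g j) 0) by (rewrite E; auto).
  assert (E2 : nth (S k) (g i) 0 = nth (S k) (g j) 0) by (rewrite E; auto).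
  unfold g in E1, E2; rewrite Hk2, Hk, !repeat_app in E1, E2; clear - E1 E2 Hi Hj.
  destruct i as [|[|[|[|i]]]]; try lia; destruct j as [|[|[|[|j]]]]; try lia;
    exfalso; rewrite ?app_nth2, ?repeat_length, ?Nat.sub_diag in E2
      by (rewrite repeat_length; auto);
    simpl in E1, E2; lra. }
assert (Hsum : T (g 0%nat ** c) + T (g 1%nat ** c) + T (g 2%nat ** c) + T (g 3%nat ** c)
  <= 1 * 2 ^ (2 ^ S m)).
{ rewrite <- csum_const; unfold T, csum; rewrite <- !rsum_plus.
  apply csum_le; intros e He; rewrite <- !ex_plus.
  rewrite <- (psi_mass (S r) (S m) (map sgn e)).
  apply (supp_ex_le _ _ _ _ (psi_supp (S r) (S m) (map sgn e) ltac:(rewrite length_map; auto))).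
  intros x _.
  assert (D : forall i j, (i < 4)%nat -> (j < 4)%nat -> i <> j ->
    eqi (g i ** c) x = 0 \/ eqi (g j ** c) x = 0).
  { intros i j Hi Hj Hij; unfold eqi; do 2 (destruct list_eq_dec; auto).
    exfalso; apply Hij, Hn; auto; apply Hinj; congruence. }
  pose proof (eqi_01 (g 0%nat ** c) x); pose proof (eqi_01 (g 1%nat ** c) x).
  pose proof (eqi_01 (g 2%nat ** c) x); pose proof (eqi_01 (g 3%nat ** c) x).
  destruct (D 0 1)%nat, (D 0 2)%nat, (D 0 3)%nat, (D 1 2)%nat, (D 1 3)%nat, (D 2 3)%nat;
    try lia; lra. }
pose proof (HT 0%nat); pose proof (HT 1%nat); pose proof (HT 2%nat); pose proof (HT 3%nat).
fold (T c); lra.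
Qed.

Lemma count_true_cons b s : count_true (b :: s) = ((if b then 1 else 0) + count_true s)%nat.
Proof. destruct b; reflexivity. Qed.

Lemma count_true_complement s :
  (count_true (xorl (repeat true (length s)) s) + count_true s = length s)%nat.
Proof.
induction s as [|b s IH]; simpl; auto.
rewrite !count_true_cons; destruct b; simpl; lia.
Qed.

Definition in_ball (w : R) (k : nat) : R := if Rle_dec (INR k) w then 1 else 0.

Lemma patterns_upto_sum m w f :
  rsum f (patterns_upto m w) = csum (2 ^ m) (fun e => in_ball w (count_true e) * f e).
Proof.
unfold patterns_upto; rewrite rsum_filter; apply rsum_ext; intros e _.
unfold in_ball; destruct Rle_dec; reflexivity.
Qed.

Lemma patterns_upto_length m w :
  INR (length (patterns_upto m w)) = csum (2 ^ m) (fun e => in_ball w (count_true e)).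
Proof.
rewrite <- (Rmult_1_l (INR _)), <- rsum_const, patterns_upto_sum.
apply csum_ext; intros; ring.
Qed.

(** Complementation permutes the cube and sends weight [k] to [n - k]; one of the two is at most
    [n / 2]. *)
Lemma half_ball_length m :
  2 ^ (2 ^ m) <= 2 * INR (length (patterns_upto m (2 ^ m / 2))).
Proof.
rewrite patterns_upto_length.
set (b e := in_ball (2 ^ m / 2) (count_true e)).
replace (2 * csum (2 ^ m) b) with
  (csum (2 ^ m) b + csum (2 ^ m) (fun e => b (xorl (repeat true (2 ^ m)) e)))
  by (rewrite csum_translate by (apply repeat_length); ring).
rewrite <- (Rmult_1_l (2 ^ (2 ^ m))), <- csum_const; unfold csum; rewrite <- rsum_plus.
apply csum_le; intros e He; unfold b, in_ball.
assert (E : INR (count_true (xorl (repeat true (2 ^ m)) e)) + INR (count_true e) = 2 ^ m).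
{ rewrite <- plus_INR, <- He, count_true_complement, He, pow_INR; reflexivity. }
do 2 destruct Rle_dec; lra.
Qed.

Lemma fail_frac_eq r m c w :
  fail_frac r m c w =
  csum (2 ^ m) (fun e => in_ball w (count_true e) *
    (1 - ex (psi r m (c ** map sgn e)) (eqi c)))
  / csum (2 ^ m) (fun e => in_ball w (count_true e)).
Proof.
unfold fail_frac; rewrite patterns_upto_length, <- patterns_upto_sum; f_equal.
apply rsum_ext; intros e _; rewrite prob_eq_ex; reflexivity.
Qed.

Lemma fail_frac_half r m c : (r < m)%nat -> rm_word (S r) (S m) c ->
  1 / 2 <= fail_frac (S r) (S m) c (2 ^ S m / 2).
Proof.
intros H Hc; rewrite fail_frac_eq.
pose proof (half_ball_length (S m)) as Hb; rewrite patterns_upto_length in Hb.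
set (b e := in_ball (2 ^ S m / 2) (count_true e)) in *.
(* Dropping the ball indicator enlarges the sum to the whole cube, where a translation replaces
   [c ** map sgn e] by an arbitrary received word. *)
assert (Hs : csum (2 ^ S m) (fun e => b e * ex (psi (S r) (S m) (c ** map sgn e)) (eqi c))
  <= 2 ^ (2 ^ S m) / 4).
{ apply Rle_trans with (2 := csum_success r m c H Hc).
  destruct (rm_word_pm _ _ _ Hc) as [Lc Pc]; destruct (pm_sgn _ Pc) as [s Es].
  assert (Ls : length s = (2 ^ S m)%nat) by (rewrite <- Lc, Es, length_map; auto).
  rewrite <- (csum_translate _ s (fun e => ex (psi (S r) (S m) (map sgn e)) (eqi c)) Ls).
  apply csum_le; intros e He; rewrite map_sgn_xorl, <- Es.
  pose proof (psi_prob_01 (S r) (S m) (c ** map sgn e) c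
    ltac:(rewrite zipw_length; rewrite ?length_map; congruence)).
  unfold b, in_ball; destruct Rle_dec; lra. }
assert (Hpos : 0 < 2 ^ (2 ^ S m)) by (apply pow_lt; lra).
set (B := csum (2 ^ S m) b) in *.
change (1 / 2 <= csum (2 ^ S m)
  (fun e => b e * (1 - ex (psi (S r) (S m) (c ** map sgn e)) (eqi c))) / B).
replace (csum (2 ^ S m) (fun e => b e * (1 - ex (psi (S r) (S m) (c ** map sgn e)) (eqi c))))
  with (B - csum (2 ^ S m) (fun e => b e * ex (psi (S r) (S m) (c ** map sgn e)) (eqi c))).
- apply Rmult_le_reg_r with B; [lra|].
  field_simplify; lra.
- unfold B, csum.
  replace (rsum b (cube (2 ^ S m))) with (rsum (fun e =>
    b e * (1 - ex (psi (S r) (S m) (c ** map sgn e)) (eqi c)) +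
    b e * ex (psi (S r) (S m) (c ** map sgn e)) (eqi c)) (cube (2 ^ S m)))
    by (apply rsum_ext; intros; ring).
  rewrite rsum_plus; ring.
Qed.

Lemma psi_cost_linear r : exists C : R, forall m, INR (psi_cost r m) <= C * 2 ^ m.
Proof.
induction r as [|r [C IH]].
- exists 1; intros m; replace (psi_cost 0 m) with (2 ^ m)%nat by (destruct m; auto).
  rewrite pow_INR; replace (INR 2) with 2 by (simpl; lra); lra.
(* With slope [C'] for [S r], the calls and the node cost at most [(C + C' + 5) * 2 ^ m], against a
   budget of [2 * C' * 2 ^ m]. *)
- exists (Rabs C + 5); intros m; pose proof (Rle_abs C); pose proof (Rabs_pos C).
  induction m as [|m IHm]; [simpl; lra|].
  assert (0 < 2 ^ m) by (apply pow_lt; lra).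
  cbn [psi_cost]; destruct Nat.leb.
  + rewrite pow_INR; replace (INR 2) with 2 by (simpl; lra); simpl pow; nra.
  + rewrite !plus_INR, mult_INR, pow_INR; specialize (IH m).
    replace (INR 5) with 5 by (simpl; lra); replace (INR 2) with 2 by (simpl; lra).
    simpl pow; nra.
Qed.

(** * Chebyshev bound over the leaves *)

Definition total (y : list R) : R := fold_right Rplus 0 y.

Lemma total_rsum y : total y = rsum (fun z => z) y.
Proof. unfold rsum; rewrite map_id; reflexivity. Qed.

(* [(z - 1)^2] with the linear term shrunk by [1 - eta], which absorbs the error of
   replacing a shell by independent symbols. *)
Definition leaf (eta z : R) : R := z * z - 2 * (1 - eta) * z + 1.

(* Union bound over the leaves of the recursion of the Chebyshev bounds
   [(S / E S - 1)^2] on [S <= 0]; [mu] is the mean of each symbol. *)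
Definition cheb (eta : R) : nat -> nat -> R -> list R -> R :=
  rm_rec (fun m mu y => leaf eta (total y / (2 ^ m * mu)))
         (fun m mu y => rsum (fun z => leaf eta (z / mu)) y)
         (fun m qv qu mu y =>
            let y1 := firstn (2 ^ m) y in
            let y2 := skipn (2 ^ m) y in
            qv (mu * mu) (y1 ** y2) + qu mu (avg y1 y2)).

Lemma leaf_0_nonneg z : 0 <= leaf 0 z.
Proof. unfold leaf; pose proof (Rle_0_sqr (z - 1)); unfold Rsqr in *; nra. Qed.

Lemma leaf_0_nonpos z : z <= 0 -> 1 <= leaf 0 z.
Proof. unfold leaf; nra. Qed.

Lemma div_nonpos z a : 0 < a -> z <= 0 -> z / a <= 0.
Proof.
intros Ha Hz; unfold Rdiv; pose proof (Rinv_0_lt_compat a Ha); nra.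
Qed.

(** No expectation is involved yet: the bound holds at each [z] and for every scale [a > 0]. The
    scale becomes the mean of the sum only when [mu] is chosen. *)
Lemma sign_dec_fail z a : 0 < a ->
  1 - ex (sign_dec z) (fun s => if Req_EM_T s 1 then 1 else 0) <= leaf 0 (z / a).
Proof.
intros Ha; unfold sign_dec; destruct Rlt_dec; [|destruct Rlt_dec].
- rewrite ex_dret; destruct Req_EM_T; [|lra]; pose proof (leaf_0_nonneg (z / a)); lra.
- rewrite ex_dret; destruct Req_EM_T; [lra|].
  pose proof (leaf_0_nonpos _ (div_nonpos z a Ha ltac:(lra))); lra.
- rewrite ex_coin; pose proof (leaf_0_nonpos _ (div_nonpos z a Ha ltac:(lra))).
  repeat destruct Req_EM_T; lra.
Qed.

Lemma eqi_cons s c t : eqi (1 :: c) (s :: t) =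
  (if Req_EM_T s 1 then 1 else 0) * eqi c t.
Proof.
unfold eqi; destruct (list_eq_dec _ t c), (list_eq_dec _ (s :: t) (1 :: c)), Req_EM_T;
  try lra; congruence.
Qed.

Lemma dmapM_fail mu y : 0 < mu ->
  1 - ex (dmapM sign_dec y) (eqi (repeat 1 (length y))) <=
  rsum (fun z => leaf 0 (z / mu)) y.
Proof.
intros Hmu; induction y as [|z y IH]; simpl.
- rewrite ex_dret, eqi_refl; unfold rsum; simpl; lra.
- set (p := ex (dmapM sign_dec y) (eqi (repeat 1 (length y)))) in *.
  set (b s := if Req_EM_T s 1 then 1 else 0).
  replace (ex _ _) with (ex (sign_dec z) b * p).
  + pose proof (sign_dec_fail z mu Hmu) as H.
    change (1 - ex (sign_dec z) b <= leaf 0 (z / mu)) in H.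
    assert (0 <= ex (sign_dec z) b <= 1).
    { split.
      - rewrite <- (Rmult_0_l (ex (sign_dec z) (fun _ => 1))), <- ex_scal.
        apply (supp_ex_le _ _ _ _ (sign_dec_supp z)); intros s _; unfold b.
        destruct Req_EM_T; lra.
      - rewrite <- (sign_dec_mass z).
        apply (supp_ex_le _ _ _ _ (sign_dec_supp z)); intros s _; unfold b.
        destruct Req_EM_T; lra. }
    assert (p <= 1).
    { rewrite <- (dmapM_mass y).
      apply (supp_ex_le _ _ _ _ (dmapM_supp y)); intros t _; apply eqi_01. }
    change (1 - ex (sign_dec z) b * p <=
      leaf 0 (z / mu) + rsum (fun z => leaf 0 (z / mu)) y).
    nra.
  + rewrite ex_dbind, Rmult_comm, <- ex_scal; apply ex_ext; intros s.
    rewrite ex_dbind, Rmult_comm; unfold p; rewrite <- ex_scal; apply ex_ext; intros t.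
    rewrite ex_dret, eqi_cons; reflexivity.
Qed.

(** On the successful path the decoded [v] is all ones, so the second call sees [avg y1 y2], exactly
    what [cheb] evaluates. Both calls succeed with probability at least [pv * pu], and
    [1 - pv * pu <= (1 - pv) + (1 - pu)]. *)
Lemma psi_fail_cheb r m : forall mu y, 0 < mu -> length y = (2 ^ m)%nat ->
  1 - ex (psi r m y) (eqi (repeat 1 (2 ^ m))) <= cheb 0 r m mu y.
Proof.
revert r m; apply (rm_ind (fun r m => forall mu y, 0 < mu -> length y = (2 ^ m)%nat ->
  1 - ex (psi r m y) (eqi (repeat 1 (2 ^ m))) <= cheb 0 r m mu y)); unfold cheb.
- intros m mu y Hmu Hy; rewrite rm_rec_rep, psi_rep.
  assert (Ha : 0 < 2 ^ m * mu) by (apply Rmult_lt_0_compat; auto; apply pow_lt; lra).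
  apply Rle_trans with (2 := sign_dec_fail (total y) _ Ha).
  apply Rplus_le_compat_l, Ropp_le_contravar; unfold md_rep; rewrite ex_dbind.
  apply (supp_ex_le _ _ _ _ (sign_dec_supp _)); intros s _; rewrite ex_dret, Hy.
  destruct Req_EM_T; [subst; rewrite eqi_refl; lra|apply eqi_01].
- intros r m H1 H2 mu y Hmu Hy; rewrite rm_rec_full, psi_full by assumption.
  rewrite <- Hy; apply dmapM_fail; assumption.
- intros r m H IHv IHu mu y Hmu Hy; rewrite rm_rec_step, psi_step by assumption; cbv zeta.
  destruct (halves _ _ Hy) as [L1 L2].
  set (y1 := firstn (2 ^ m) y) in *; set (y2 := skipn (2 ^ m) y) in *.
  assert (Lv : length (y1 ** y2) = (2 ^ m)%nat) by (rewrite zipw_length; congruence).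
  assert (Lu : length (avg y1 y2) = (2 ^ m)%nat).
  { unfold avg; rewrite zipw_length; congruence. }
  specialize (IHv (mu * mu) (y1 ** y2) ltac:(nra) Lv).
  specialize (IHu mu (avg y1 y2) Hmu Lu).
  set (one := repeat 1 (2 ^ m)) in *.
  assert (E1 : repeat 1 (2 ^ S m) = one ++ one).
  { unfold one; rewrite <- repeat_app; f_equal; simpl; lia. }
  assert (Eo : one ** one = one) by (apply had_ones, repeat_length).
  assert (E2 : y2 ** one = y2) by (rewrite had_comm; apply had_ones; assumption).
  pose proof (psi_prob_01 r m _ one Lv) as Hv01.
  pose proof (psi_prob_01 (S r) m _ one Lu) as Hu01.
  set (pv := ex (psi r m (y1 ** y2)) (eqi one)) in *.
  set (pu := ex (psi (S r) m (avg y1 y2)) (eqi one)) in *.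
  assert (Hp : pv * pu <= ex (dbind (psi r m (y1 ** y2)) (fun v =>
    dbind (psi (S r) m (avg y1 (y2 ** v))) (fun u => dret (u ++ u ** v))))
    (eqi (repeat 1 (2 ^ S m)))).
  { rewrite ex_dbind, Rmult_comm; unfold pv; rewrite <- ex_scal.
    apply (supp_ex_le _ _ _ _ (psi_supp r m _ Lv)); intros v Hv.
    rewrite ex_dbind.
    assert (Lu' : length (avg y1 (y2 ** v)) = (2 ^ m)%nat).
    { unfold avg; rewrite zipw_length; rewrite ?zipw_length; congruence. }
    destruct (list_eq_dec Req_EM_T v one) as [->|Hne].
    - rewrite eqi_refl, Rmult_1_r, E2.
      apply (supp_ex_le _ _ _ _ (psi_supp (S r) m _ Lu)); intros u Hu.
      rewrite ex_dret, E1; destruct (list_eq_dec Req_EM_T u one) as [->|Hne].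
      + rewrite Eo, !eqi_refl; lra.
      + rewrite (eqi_neq one u Hne); apply eqi_01.
    - rewrite (eqi_neq one v Hne), Rmult_0_r.
      rewrite <- (Rmult_0_l (ex (psi (S r) m (avg y1 (y2 ** v))) (fun _ => 1))), <- ex_scal.
      apply (supp_ex_le _ _ _ _ (psi_supp (S r) m _ Lu')); intros u Hu.
      rewrite ex_dret, Rmult_0_l; apply eqi_01. }
  nra.
Qed.

(** * Expectations over independent symbols *)

Fixpoint iid {A} (D : Dist A) (n : nat) (F : list A -> R) : R :=
  match n with
  | O => F []
  | S n' => ex D (fun x => iid D n' (fun l => F (x :: l)))
  end.

Section Iid.
Context {A : Type} (D : Dist A).

Lemma iid_ext n F G : (forall y, length y = n -> F y = G y) -> iid D n F = iid D n G.
Proof.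
revert F G; induction n as [|n IH]; intros F G H; simpl; auto.
apply ex_ext; intros x; apply IH; intros y Hy; apply H; simpl; auto.
Qed.

Lemma iid_plus n F G : iid D n (fun y => F y + G y) = iid D n F + iid D n G.
Proof.
revert F G; induction n as [|n IH]; intros F G; simpl; auto.
rewrite <- ex_plus; apply ex_ext; intros x; apply IH.
Qed.

Lemma iid_scal n a F : iid D n (fun y => a * F y) = a * iid D n F.
Proof.
revert F; induction n as [|n IH]; intros F; simpl; auto.
rewrite <- ex_scal; apply ex_ext; intros x; apply IH.
Qed.

Lemma iid_app n1 n2 F : iid D (n1 + n2) F =
  iid D n1 (fun y1 => iid D n2 (fun y2 => F (y1 ++ y2))).
Proof.
revert F; induction n1 as [|n IH]; intros F; simpl; auto.
apply ex_ext; intros x; apply IH.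
Qed.

Lemma iid_ex_swap {B} (D' : Dist B) n F :
  iid D n (fun y => ex D' (F y)) = ex D' (fun b => iid D n (fun y => F y b)).
Proof.
revert F; induction n as [|n IH]; intros F; simpl; auto.
rewrite <- ex_swap; apply ex_ext; intros x.
apply (IH (fun l => F (x :: l))).
Qed.

Lemma iid_map {B} (h : A -> B) n F :
  iid D n (fun y => F (map h y)) = iid (dbind D (fun x => dret (h x))) n F.
Proof.
revert F; induction n as [|n IH]; intros F; simpl; auto.
rewrite ex_dbind; apply ex_ext; intros x; rewrite ex_dret.
apply (IH (fun l => F (h x :: l))).
Qed.

Hypothesis D_mass : ex D (fun _ => 1) = 1.

Lemma ex_const a : ex D (fun _ => a) = a.
Proof.
rewrite (ex_ext D _ (fun _ => a * 1)) by (intros; ring).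
rewrite ex_scal, D_mass; ring.
Qed.

Lemma iid_const n a : iid D n (fun _ => a) = a.
Proof.
induction n as [|n IH]; simpl; auto.
rewrite (ex_ext D _ (fun _ => a)); auto using ex_const.
Qed.

Lemma iid_rsum n g : iid D n (fun y => rsum g y) = INR n * ex D g.
Proof.
induction n as [|n IH]; [unfold rsum; simpl; lra|].
rewrite S_INR; simpl.
rewrite (ex_ext D _ (fun x => g x + INR n * ex D g)).
- rewrite ex_plus, ex_const; ring.
- intros x; rewrite <- IH, <- (iid_const n (g x)) at 1; rewrite <- iid_plus; reflexivity.
Qed.

Lemma iid_rsum_sqr n g : iid D n (fun y => rsum g y * rsum g y) =
  INR n * ex D (fun x => g x * g x) + INR n * (INR n - 1) * (ex D g * ex D g).
Proof.
induction n as [|n IH]; [unfold rsum; simpl; lra|].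
rewrite S_INR; simpl.
set (s := ex D (fun x => g x * g x)) in *; set (mu := ex D g) in *.
rewrite (ex_ext D _ (fun x => g x * g x + (2 * (INR n * mu) * g x +
  (INR n * s + INR n * (INR n - 1) * (mu * mu))))).
- rewrite !ex_plus, ex_scal, !ex_const by assumption; fold s mu; ring.
- intros x; rewrite <- IH.
  rewrite (iid_ext n _ (fun l => g x * g x + (2 * g x * rsum g l + rsum g l * rsum g l))).
  + rewrite !iid_plus, iid_const, iid_scal, iid_rsum; fold mu; ring.
  + intros y _; unfold rsum; simpl; ring.
Qed.

End Iid.

Definition dop (op : R -> R -> R) (D : Dist R) : Dist R :=
  dbind D (fun a => dbind D (fun b => dret (op a b))).

Lemma ex_dop op D f : ex (dop op D) f = ex D (fun a => ex D (fun b => f (op a b))).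
Proof.
unfold dop; rewrite ex_dbind; apply ex_ext; intros a; rewrite ex_dbind.
apply ex_ext; intros b; apply ex_dret.
Qed.

(** Pairing two independent samples coordinatewise gives independent pairs; the head of the second
    sample is moved past the tail of the first by [iid_ex_swap]. *)
Lemma iid_zipw op D n F :
  iid D n (fun y1 => iid D n (fun y2 => F (zipw op y1 y2))) = iid (dop op D) n F.
Proof.
revert F; induction n as [|n IH]; intros F; simpl; auto.
rewrite ex_dop; apply ex_ext; intros a.
rewrite (iid_ex_swap D D n (fun l b => iid D n (fun l' => F (op a b :: zipw op l l')))).
apply ex_ext; intros b; apply (IH (fun l => F (op a b :: l))).
Qed.

Lemma iid_halves op D m F :
  iid D (2 ^ S m) (fun y => F (zipw op (firstn (2 ^ m) y) (skipn (2 ^ m) y))) =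
  iid (dop op D) (2 ^ m) F.
Proof.
replace (2 ^ S m)%nat with (2 ^ m + 2 ^ m)%nat by (simpl; lia).
rewrite iid_app, <- iid_zipw; apply iid_ext; intros y1 H1; apply iid_ext; intros y2 H2.
rewrite <- H1, firstn_app, skipn_app, Nat.sub_diag, firstn_all, skipn_all, app_nil_r.
reflexivity.
Qed.

(** The mean of [cheb 0] for independent symbols. It depends on the relative variance [x] alone,
    since [mu] cancels in every leaf. *)
Definition cheb_mean : nat -> nat -> R -> R :=
  rm_rec (fun m x => x / 2 ^ m) (fun m x => 2 ^ m * x)
         (fun m fv fu x => fv (x * x + 2 * x) + fu (x / 2)).

(** A full-space leaf counts once for each of its [2 ^ m] symbols; every count carries an error
    [2 * eta]. *)
Definition leaves : nat -> nat -> R :=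
  rm_rec (fun _ => 1) (fun m => 2 ^ m) (fun _ a b => a + b).

(* [x] is the relative variance of a symbol. *)
Lemma iid_cheb eta r m : forall D mu x, mu <> 0 ->
  ex D (fun _ => 1) = 1 -> ex D (fun z => z) = mu ->
  ex D (fun z => z * z) = mu * mu * (1 + x) ->
  iid D (2 ^ m) (cheb eta r m mu) = cheb_mean r m x + 2 * eta * leaves r m.
Proof.
revert r m; apply (rm_ind (fun r m => forall D mu x, mu <> 0 ->
  ex D (fun _ => 1) = 1 -> ex D (fun z => z) = mu ->
  ex D (fun z => z * z) = mu * mu * (1 + x) ->
  iid D (2 ^ m) (cheb eta r m mu) = cheb_mean r m x + 2 * eta * leaves r m));
  unfold cheb, cheb_mean, leaves.
- intros m D mu x Hmu D0 D1 D2; rewrite !rm_rec_rep.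
  assert (HN : 2 ^ m <> 0) by (apply pow_nonzero; lra).
  rewrite (iid_ext D _ _ (fun y => / (2 ^ m * mu * (2 ^ m * mu)) *
    (rsum (fun z => z) y * rsum (fun z => z) y) +
    (- (2 * (1 - eta)) / (2 ^ m * mu) * rsum (fun z => z) y + 1))).
  + rewrite !iid_plus, !iid_scal, iid_const, iid_rsum, iid_rsum_sqr by assumption.
    rewrite D1, D2, pow_INR; replace (INR 2) with 2 by (simpl; lra); field; auto.
  + intros y _; rewrite total_rsum; unfold leaf; field; auto.
- intros r m H1 H2 D mu x Hmu D0 D1 D2; rewrite !rm_rec_full by assumption.
  rewrite iid_rsum by assumption.
  rewrite (ex_ext D _ (fun z => / (mu * mu) * (z * z) +
    (- (2 * (1 - eta)) / mu * z + 1))) by (intros; unfold leaf; field; auto).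
  rewrite !ex_plus, !ex_scal, D0, D1, D2, pow_INR.
  replace (INR 2) with 2 by (simpl; lra); field; auto.
- intros r m H IHv IHu D mu x Hmu D0 D1 D2; rewrite !rm_rec_step by assumption.
  cbv zeta; rewrite iid_plus.
  fold (cheb eta); unfold avg.
  rewrite (iid_halves Rmult D m (cheb eta r m (mu * mu))).
  rewrite (iid_halves (fun a b => (a + b) / 2) D m (cheb eta (S r) m mu)).
  unfold cheb.
  assert (mu * mu <> 0) by (apply Rmult_integral_contrapositive_currified; assumption).
  rewrite IHv with (x := x * x + 2 * x), IHu with (x := x / 2); auto; try ring;
    rewrite ex_dop.
  + rewrite (ex_ext D _ (fun _ => 1)); auto.
  + rewrite (ex_ext D _ (fun a => / 2 * a + mu / 2)).
    * rewrite ex_plus, ex_scal, ex_const, D1 by auto; field.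
    * intros a; rewrite (ex_ext D _ (fun b => / 2 * b + a / 2)) by (intros; field).
      rewrite ex_plus, ex_scal, ex_const, D1 by auto; field.
  + rewrite (ex_ext D _ (fun a => / 4 * (a * a) + (mu / 2 * a + mu * mu * (1 + x) / 4))).
    * rewrite !ex_plus, !ex_scal, ex_const, D1, D2 by auto; field.
    * intros a; rewrite (ex_ext D _ (fun b => / 4 * (b * b) + (a / 2 * b + a * a / 4)))
        by (intros; field).
      rewrite !ex_plus, !ex_scal, ex_const, D1, D2 by auto; field.
  + rewrite (ex_ext D _ (fun _ => 1)); auto.
  + rewrite (ex_ext D _ (fun a => mu * a)).
    * rewrite ex_scal, D1; ring.
    * intros a; rewrite ex_scal, D1; ring.
  + rewrite (ex_ext D _ (fun a => mu * mu * (1 + x) * (a * a))).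
    * rewrite ex_scal, D2; ring.
    * intros a; rewrite (ex_ext D _ (fun b => a * a * (b * b))) by (intros; ring).
      rewrite ex_scal, D2; ring.
Qed.

(** * Characters on shells *)

(** The Walsh character with support [s]. *)
Fixpoint chi (s e : list bool) : R :=
  match s, e with
  | a :: s', b :: e' => (if a then sgn b else 1) * chi s' e'
  | _, _ => 1
  end.

Lemma chi_xorl n s s' e : length s = n -> length s' = n -> length e = n ->
  chi (xorl s s') e = chi s e * chi s' e.
Proof.
intros <-; revert s' e; induction s as [|a s IH]; intros [|a' s'] [|b e] H1 H2;
  simpl in *; try discriminate; [ring|].
rewrite IH by lia; destruct a, a', b; unfold sgn; simpl; ring.
Qed.

Lemma count_true_xorl s s' :
  (count_true (xorl s s') <= count_true s + count_true s')%nat.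
Proof.
revert s'; induction s as [|a s IH]; intros [|a' s']; simpl; try (cbn; lia).
rewrite !count_true_cons; specialize (IH s'); destruct a, a'; simpl; lia.
Qed.

Lemma xorl_length s s' : length s = length s' -> length (xorl s s') = length s.
Proof.
revert s'; induction s as [|a s IH]; intros [|a' s'] H; simpl in *; auto; try lia.
Qed.

Lemma count_true_le s : (count_true s <= length s)%nat.
Proof. apply (filter_length_le (fun b => b) s). Qed.

Lemma count_true_repeat_false n : count_true (repeat false n) = 0%nat.
Proof. induction n; auto. Qed.

Lemma count_true_repeat_true n : count_true (repeat true n) = n.
Proof. unfold count_true; induction n; simpl; auto. Qed.

Lemma count_true_app s s' : count_true (s ++ s') = (count_true s + count_true s')%nat.
Proof. unfold count_true; rewrite filter_app, length_app; reflexivity. Qed.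

(** The weight [h] stays arbitrary because stripping a leading [true] shifts it; a fixed shell would
    not survive the induction. *)
Definition wsum (h : nat -> R) (n : nat) (f : list bool -> R) : R :=
  csum n (fun e => h (count_true e) * f e).

Lemma wsum_S h n f : wsum h (S n) f =
  wsum h n (fun e => f (false :: e)) + wsum (fun k => h (S k)) n (fun e => f (true :: e)).
Proof. unfold wsum; rewrite csum_S; reflexivity. Qed.

Lemma wsum_ext h n f g : (forall e, length e = n -> f e = g e) -> wsum h n f = wsum h n g.
Proof. intros H; apply csum_ext; intros e He; rewrite H; auto. Qed.

Lemma wsum_plus h n f g : wsum h n (fun e => f e + g e) = wsum h n f + wsum h n g.
Proof.
unfold wsum, csum; rewrite <- rsum_plus; apply rsum_ext; intros; ring.
Qed.

Lemma wsum_scal h n a f : wsum h n (fun e => a * f e) = a * wsum h n f.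
Proof.
unfold wsum, csum; rewrite <- rsum_scal; apply rsum_ext; intros; ring.
Qed.

Lemma wsum_chi_cons h n a s : wsum h (S n) (chi (a :: s)) =
  wsum h n (chi s) + (if a then -1 else 1) * wsum (fun k => h (S k)) n (chi s).
Proof.
rewrite wsum_S, <- wsum_scal; f_equal; apply wsum_ext; intros e _; simpl;
  destruct a; simpl; ring.
Qed.

Lemma wsum_chi_perm s s' : Permutation s s' ->
  forall h, wsum h (length s) (chi s) = wsum h (length s') (chi s').
Proof.
induction 1 as [|a s s' P IH|a b s|s s' s'' P IH P' IH']; intros h; auto.
- simpl length; rewrite !wsum_chi_cons, !IH; reflexivity.
- simpl length; rewrite !wsum_chi_cons; ring.
- rewrite IH; apply IH'.
Qed.

Definition canon (n k : nat) : list bool := repeat true k ++ repeat false (n - k).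

Lemma canon_perm s : Permutation s (canon (length s) (count_true s)).
Proof.
unfold canon; induction s as [|a s IH]; [apply perm_nil|].
rewrite count_true_cons; destruct a; simpl.
- apply perm_skip; exact IH.
- assert (L : (count_true s <= length s)%nat).
  { apply count_true_le. }
  destruct (count_true s) as [|k] eqn:E.
  + rewrite Nat.sub_0_r in IH; simpl in *; apply perm_skip; exact IH.
  + replace (length s - k)%nat with (S (length s - S k)) by lia.
    simpl repeat at 2; apply Permutation_cons_app; exact IH.
Qed.

Lemma wsum_chi_canon h n s : length s = n ->
  wsum h n (chi s) = wsum h n (chi (canon n (count_true s))).
Proof.
intros <-; rewrite (wsum_chi_perm _ _ (canon_perm s)); f_equal.
rewrite <- (Permutation_length (canon_perm s)); reflexivity.
Qed.

Fixpoint flips (s : list bool) : list (list bool) :=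
  match s with
  | [] => []
  | a :: s' => (negb a :: s') :: map (cons a) (flips s')
  end.

Lemma flips_length s s' : In s' (flips s) -> length s' = length s.
Proof.
revert s'; induction s as [|a s IH]; simpl; intros s'; [intros []|].
intros [<-|H]; [reflexivity|apply in_map_iff in H as (t & <- & Ht)].
simpl; rewrite (IH t); auto.
Qed.

(** Each sign squares to 1, so multiplying a character by the symbol at position [i] toggles [i] in
    its support. *)
Lemma chi_flips s e : length s = length e ->
  rsum (fun s' => chi s' e) (flips s) = total (map sgn e) * chi s e.
Proof.
revert e; induction s as [|a s IH]; intros [|b e] H; try discriminate.
- unfold rsum; simpl; lra.
- change (flips (a :: s)) with ((negb a :: s) :: map (cons a) (flips s)).
  change (chi (negb a :: s) (b :: e) +
    rsum (fun s' => chi s' (b :: e)) (map (cons a) (flips s)) =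
    (sgn b + total (map sgn e)) * chi (a :: s) (b :: e)).
  rewrite rsum_map; simpl.
  rewrite rsum_scal, IH by (simpl in H; lia).
  destruct a, b; unfold sgn; simpl; ring.
Qed.

Lemma total_sgn e : total (map sgn e) = INR (length e) - 2 * INR (count_true e).
Proof.
induction e as [|b e IH]; [unfold total, count_true; simpl; lra|].
change (total (map sgn (b :: e))) with (sgn b + total (map sgn e)).
rewrite count_true_cons, plus_INR, IH; simpl length; rewrite S_INR.
destruct b; unfold sgn; simpl; lra.
Qed.

(** Flipping a [false] raises the degree, flipping a [true] lowers it. In degree 0 the truncated
    predecessor is multiplied by zero. *)
Lemma rsum_flips (g : nat -> R) s :
  rsum (fun s' => g (count_true s')) (flips s) =
  (INR (length s) - INR (count_true s)) * g (S (count_true s)) +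
  INR (count_true s) * g (count_true s - 1)%nat.
Proof.
revert g; induction s as [|a s IH]; intros g; [unfold rsum, count_true; simpl; ring|].
change (flips (a :: s)) with ((negb a :: s) :: map (cons a) (flips s)).
change (g (count_true (negb a :: s)) +
  rsum (fun s' => g (count_true s')) (map (cons a) (flips s)) =
  (INR (S (length s)) - INR (count_true (a :: s))) * g (S (count_true (a :: s))) +
  INR (count_true (a :: s)) * g (count_true (a :: s) - 1)%nat).
rewrite rsum_map, !count_true_cons, S_INR.
rewrite (rsum_ext _ (fun s' => g ((if a then 1 else 0) + count_true s')%nat))
  by (intros; rewrite count_true_cons; reflexivity).
rewrite (IH (fun k => g ((if a then 1 else 0) + k)%nat)).
destruct a; cbn [negb]; rewrite ?Nat.add_0_l.
- change (1 + count_true s)%nat with (S (count_true s)).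
  rewrite S_INR, Nat.sub_succ, Nat.sub_0_r.
  destruct (count_true s) as [|k]; [simpl; ring|].
  rewrite Nat.sub_succ, Nat.sub_0_r; simpl Nat.add; ring.
- simpl Nat.add; ring.
Qed.

Definition shell (t : nat) (k : nat) : R := if Nat.eq_dec k t then 1 else 0.

Lemma wsum_nonneg h n f : (forall k, 0 <= h k) -> (forall e, 0 <= f e) -> 0 <= wsum h n f.
Proof.
intros Hh Hf; unfold wsum.
rewrite <- (Rmult_0_l (2 ^ n)), <- csum_const; apply csum_le; intros.
apply Rmult_le_pos; auto.
Qed.

Lemma wsum_rsum {A} h n (f : A -> list bool -> R) l :
  wsum h n (fun e => rsum (fun x => f x e) l) = rsum (fun x => wsum h n (f x)) l.
Proof.
unfold wsum, csum; rewrite <- rsum_swap; apply rsum_ext; intros e _.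
symmetry; apply rsum_scal.
Qed.

(* On a shell the sum of all symbols is constant, which gives the three-term
   recurrence of the Krawtchouk polynomials. *)
Lemma krawtchouk_rec n t k : (k <= n)%nat ->
  let g k := wsum (shell t) n (chi (canon n k)) in
  (INR n - 2 * INR t) * g k = (INR n - INR k) * g (S k) + INR k * g (k - 1)%nat.
Proof.
intros Hk g; set (s := canon n k).
assert (Ls : length s = n).
{ unfold s, canon; rewrite length_app, !repeat_length; lia. }
assert (Cs : count_true s = k).
{ unfold s, canon; rewrite count_true_app, count_true_repeat_true, count_true_repeat_false.
  lia. }
pose proof (rsum_flips g s) as H; rewrite Ls, Cs in H; rewrite <- H.
rewrite (rsum_ext _ (fun s' => wsum (shell t) n (chi s'))).
- rewrite <- wsum_rsum.
  rewrite (wsum_ext _ _ _ _ (fun e He => chi_flips s e (eq_trans Ls (eq_sym He)))).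
  unfold g; fold s; rewrite <- wsum_scal; unfold wsum; apply csum_ext; intros e He.
  unfold shell; destruct Nat.eq_dec as [E|]; [|ring].
  rewrite total_sgn, He, E; ring.
- intros s' Hs'; apply flips_length in Hs'; symmetry; apply wsum_chi_canon; congruence.
Qed.

(** For independent symbols the ratio would be exactly [e]; the term in [g (k - 1)] perturbs it. If
    the previous ratio lies between [e / 2] and [e], the relative perturbation is at most
    [2 K / (N e^2)], and [4 K <= N e^2] keeps this below [1 / 2], which closes the induction. *)
Lemma rec_ratio_bounds N e K (g : nat -> R) : 0 < e <= 1 -> 4 * INR K <= N * (e * e) ->
  (forall k, (k < K)%nat -> N * e * g k = (N - INR k) * g (S k) + INR k * g (k - 1)%nat) ->
  0 <= g 0%nat ->
  forall k, (k < K)%nat -> 0 <= g k /\ 0 <= g (S k) /\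
    e * (1 - 2 * INR K / (N * (e * e))) * g k <= g (S k) <= e * g k.
Proof.
intros He HN Hrec H0 k; induction k as [|k IH]; intros Hk.
- assert (1 <= INR K) by (apply (le_INR 1); lia).
  assert (0 < N) by nra.
  specialize (Hrec _ Hk); simpl INR in Hrec.
  assert (E : g 1%nat = e * g 0%nat) by (apply Rmult_eq_reg_l with N; lra).
  assert (0 <= 2 * INR K / (N * (e * e))).
  { apply Rmult_le_pos; [lra|left; apply Rinv_0_lt_compat; nra]. }
  rewrite E; assert (0 <= e * g 0%nat) by nra; repeat split; auto; nra.
- destruct IH as (Ha & Hb & Hl & Hu); [lia|].
  specialize (Hrec _ Hk); rewrite Nat.sub_succ, Nat.sub_0_r in Hrec.
  assert (HjK : INR (S k) <= INR K) by (apply le_INR; lia).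
  assert (Hj : 1 <= INR (S k)) by (apply (le_INR 1); lia).
  set (j := INR (S k)) in *; set (a := g k) in *; set (b := g (S k)) in *.
  set (c := g (S (S k))) in *; set (K' := INR K) in *.
  assert (HNe : 0 < N * (e * e)) by nra.
  assert (HNpos : 0 < N) by nra.
  assert (N * (e * e) <= N * 1) by (apply Rmult_le_compat_l; nra).
  assert (HNj : 0 < N - j) by lra.
  assert (Hth : 2 * K' / (N * (e * e)) <= 1 / 2).
  { apply Rmult_le_reg_r with (N * (e * e)); auto; field_simplify; nra. }
  (* The previous ratio is at least [e / 2]; this is the source of the factor 2 in the error
     term. *)
  assert (Hab : e * a <= 2 * b) by nra.
  assert (Hc : j * (2 * b) >= j * (e * a)) by (apply Rle_ge, Rmult_le_compat_l; lra).
  assert (Hc' : e * ((N - j) * c) >= b * (N * (e * e) - 2 * j)) by nra.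
  assert (0 <= b * (N * (e * e) - 2 * j)) by (apply Rmult_le_pos; lra).
  assert (Hc0 : 0 <= e * ((N - j) * c)) by lra.
  assert (c0 : 0 <= c).
  { apply Rmult_le_reg_l with (e * (N - j)); nra. }
  repeat split; auto.
  + apply Rmult_le_reg_l with (N * e); [nra|].
    replace (N * e * (e * (1 - 2 * K' / (N * (e * e))) * b)) with
      (b * (N * (e * e) - 2 * K')) by (field; lra).
    assert (b * K' >= b * j) by nra.
    assert (0 <= e * j * c) by (repeat apply Rmult_le_pos; lra).
    nra.
  + apply Rmult_le_reg_l with (N - j); [lra|].
    assert (e * b <= a) by nra.
    nra.
Qed.

(** The losses of successive ratios compound by Bernoulli's inequality [(1 - th)^k >= 1 - k * th],
    and [K * th] is the stated error. *)
Lemma rec_bounds N e K (g : nat -> R) : 0 < e <= 1 -> 4 * INR K <= N * (e * e) ->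
  (forall k, (k < K)%nat -> N * e * g k = (N - INR k) * g (S k) + INR k * g (k - 1)%nat) ->
  0 <= g 0%nat ->
  forall k, (k <= K)%nat ->
    (1 - 2 * (INR K * INR K) / (N * (e * e))) * (g 0%nat * e ^ k) <= g k <= g 0%nat * e ^ k.
Proof.
intros He HN Hrec H0.
assert (Hpow : forall k, 0 < e ^ k) by (intros; apply pow_lt; lra).
destruct K as [|K'].
{ intros k Hk; replace k with 0%nat by lia; simpl; lra. }
set (K := S K') in *.
assert (HK : 1 <= INR K) by (apply (le_INR 1); lia).
set (th := 2 * INR K / (N * (e * e))).
assert (Hth : 0 <= th).
{ apply Rmult_le_pos; [lra|left; apply Rinv_0_lt_compat; lra]. }
assert (Hth2 : th <= 1 / 2).
{ apply Rmult_le_reg_r with (N * (e * e)); [lra|]; unfold th; field_simplify; nra. }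
assert (B : forall k, (k <= K)%nat ->
  (1 - INR k * th) * (g 0%nat * e ^ k) <= g k <= g 0%nat * e ^ k).
{ induction k as [|k IH]; intros Hk; [simpl; lra|].
  destruct IH as [Hl Hu]; [lia|].
  destruct (rec_ratio_bounds N e K g He HN Hrec H0 k) as (G0 & G1 & Gl & Gu); [lia|].
  fold th in Gl; rewrite S_INR; simpl pow; pose proof (pos_INR k); pose proof (Hpow k).
  assert (0 <= g 0%nat * e ^ k) by nra.
  set (p := g 0%nat * e ^ k) in *.
  replace (g 0%nat * (e * e ^ k)) with (e * p) by (unfold p; ring).
  split; [|apply Rle_trans with (1 := Gu); apply Rmult_le_compat_l; lra].
  clearbody th p; apply Rle_trans with (2 := Gl).
  assert (e * (1 - th) * ((1 - INR k * th) * p) <= e * (1 - th) * g k)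
    by (apply Rmult_le_compat_l; nra).
  assert (0 <= e * p * (INR k * (th * th))) by (repeat apply Rmult_le_pos; lra).
  nra. }
intros k Hk; destruct (B k Hk) as [Hl Hu]; split; auto.
apply Rle_trans with (2 := Hl); apply Rmult_le_compat_r.
- pose proof (Hpow k); nra.
- replace (2 * (INR K * INR K) / (N * (e * e))) with (INR K * th) by (unfold th; field; split; nra).
  assert (INR k <= INR K) by (apply le_INR; lia); nra.
Qed.

(** Parametrized so that the sign of the bit has mean [e]. *)
Definition bern (e : R) : Dist bool := [((1 + e) / 2, false); ((1 - e) / 2, true)].

Lemma iid_bern_chi e n s : length s = n -> iid (bern e) n (chi s) = e ^ count_true s.
Proof.
intros <-; induction s as [|a s IH]; simpl; [reflexivity|].
rewrite (ex_ext _ _ (fun b => (if a then sgn b else 1) * e ^ count_true s)).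
- rewrite count_true_cons; unfold ex, rsum, bern; destruct a; simpl; field.
- intros b; rewrite iid_scal, IH; reflexivity.
Qed.

Lemma shell_chi_bounds n t K e : e = 1 - 2 * INR t / INR n -> 0 < e <= 1 ->
  4 * INR K <= INR n * (e * e) ->
  let c := wsum (shell t) n (fun _ => 1) in
  forall s, length s = n -> (count_true s <= K)%nat ->
  (1 - 2 * (INR K * INR K) / (INR n * (e * e))) * (c * iid (bern e) n (chi s))
    <= wsum (shell t) n (chi s) <= c * iid (bern e) n (chi s).
Proof.
intros Ee He HK c s Ls Cs.
(* For [K = 0] the hypothesis [HK] does not force [n > 0], but only the constant character
   remains. *)
destruct (Nat.eq_dec K 0) as [->|HK0].
{ assert (E : forall e', chi s e' = 1).
  { clear - Cs; induction s as [|a s IH]; intros [|b e']; simpl; auto.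
    rewrite count_true_cons in Cs; rewrite IH by lia; destruct a; [simpl in Cs; lia|ring]. }
  rewrite iid_bern_chi by assumption; replace (count_true s) with 0%nat by lia.
  rewrite (wsum_ext _ _ (chi s) (fun _ => 1)) by auto; fold c; simpl; unfold Rdiv; lra. }
assert (1 <= INR K) by (apply (le_INR 1); lia).
assert (Hn : 0 < INR n) by nra.
assert (INR n * (e * e) <= INR n * 1) by (apply Rmult_le_compat_l; nra).
assert (HKn : (K <= n)%nat) by (apply INR_le; lra).
rewrite iid_bern_chi, (wsum_chi_canon _ n s Ls) by assumption.
set (g k := wsum (shell t) n (chi (canon n k))).
assert (Hc : c = g 0%nat).
{ apply wsum_ext; intros e' _; unfold canon; simpl.
  clear; generalize (n - 0)%nat; induction e' as [|b e' IH]; intros [|j]; simpl; auto.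
  rewrite <- IH; ring. }
rewrite Hc; apply (rec_bounds (INR n) e K g); auto.
- intros k Hk; pose proof (krawtchouk_rec n t k ltac:(lia)) as H1; fold g in H1.
  cbv zeta in H1; fold (g k) (g (S k)) (g (k - 1)%nat) in H1; rewrite <- H1, Ee.
  field; lra.
- rewrite <- Hc; apply wsum_nonneg; [|intros; lra].
  intros k; unfold shell; destruct Nat.eq_dec; lra.
Qed.

(* Nonnegative combinations of characters of degree at most [k]. *)
Definition pos_poly (n k : nat) (f : list bool -> R) : Prop :=
  exists l : list (R * list bool),
    (forall ca, In ca l ->
       0 <= fst ca /\ length (snd ca) = n /\ (count_true (snd ca) <= k)%nat) /\
    forall e, length e = n -> f e = rsum (fun ca => fst ca * chi (snd ca) e) l.

Lemma pos_poly_weaken n k k' f : (k <= k')%nat -> pos_poly n k f -> pos_poly n k' f.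
Proof.
intros Hk (l & Hl & Hf); exists l; split; auto.
intros ca Hca; destruct (Hl ca Hca) as (H1 & H2 & H3); repeat split; auto; lia.
Qed.

Lemma pos_poly_ext n k f g : (forall e, length e = n -> f e = g e) ->
  pos_poly n k f -> pos_poly n k g.
Proof.
intros H (l & Hl & Hf); exists l; split; auto; intros e He; rewrite <- H; auto.
Qed.

Lemma pos_poly_plus n k f g : pos_poly n k f -> pos_poly n k g ->
  pos_poly n k (fun e => f e + g e).
Proof.
intros (l & Hl & Hf) (l' & Hl' & Hg); exists (l ++ l'); split.
- intros ca Hca; apply in_app_iff in Hca as []; auto.
- intros e He; rewrite rsum_app, Hf, Hg; auto.
Qed.

Lemma pos_poly_chi n s : length s = n -> pos_poly n (count_true s) (chi s).
Proof.
intros Hs; exists [(1, s)]; split.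
- intros ca [<-|[]]; simpl; repeat split; auto; lra.
- intros e He; unfold rsum; simpl; ring.
Qed.

Lemma pos_poly_const n a k : 0 <= a -> pos_poly n k (fun _ => a).
Proof.
intros Ha; exists [(a, repeat false n)]; split.
- intros ca [<-|[]]; simpl; repeat split; auto; [apply repeat_length|].
  rewrite count_true_repeat_false; lia.
- intros e <-; unfold rsum; simpl.
  replace (chi _ e) with 1; [ring|].
  induction e as [|b e IH]; simpl; auto; rewrite <- IH; ring.
Qed.

(** A product of characters is a character, so coefficients stay nonnegative and degrees at most
    add. *)
Lemma pos_poly_mult n k k' f g : pos_poly n k f -> pos_poly n k' g ->
  pos_poly n (k + k') (fun e => f e * g e).
Proof.
intros (l & Hl & Hf) (l' & Hl' & Hg).
exists (map (fun p => (fst (fst p) * fst (snd p), xorl (snd (fst p)) (snd (snd p))))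
  (list_prod l l')); split.
- intros ca Hca; apply in_map_iff in Hca as ([x y] & <- & Hxy).
  apply in_prod_iff in Hxy as [Hx Hy]; simpl.
  destruct (Hl x Hx) as (X1 & X2 & X3); destruct (Hl' y Hy) as (Y1 & Y2 & Y3).
  repeat split; [apply Rmult_le_pos; auto|rewrite xorl_length; congruence|].
  pose proof (count_true_xorl (snd x) (snd y)); lia.
- intros e He; rewrite Hf, Hg, rsum_map by assumption; simpl; clear Hf Hg.
  induction l as [|x l IH]; simpl; [unfold rsum; simpl; ring|].
  rewrite rsum_app, rsum_map, <- IH by (intros; apply Hl; right; assumption).
  change (rsum (fun ca => fst ca * chi (snd ca) e) (x :: l)) with
    (fst x * chi (snd x) e + rsum (fun ca => fst ca * chi (snd ca) e) l).
  rewrite Rmult_plus_distr_r; f_equal; rewrite <- rsum_scal; apply rsum_ext.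
  intros y Hy; simpl; destruct (Hl x (or_introl eq_refl)) as (X1 & X2 & X3).
  destruct (Hl' y Hy) as (Y1 & Y2 & Y3).
  rewrite (chi_xorl n) by auto; ring.
Qed.

Lemma pos_poly_scal n k a f : 0 <= a -> pos_poly n k f -> pos_poly n k (fun e => a * f e).
Proof.
intros Ha Hf; apply (pos_poly_mult n 0 k (fun _ => a)); auto.
apply pos_poly_const; assumption.
Qed.

(** The symbols as functions of the error pattern. Running the recursion of [cheb] on functions
    instead of numbers keeps track of the degree of each leaf input. *)
Fixpoint coords (n : nat) : list (list bool -> R) :=
  match n with
  | O => []
  | S n' => (fun e => sgn (hd false e)) :: map (fun f e => f (tl e)) (coords n')
  end.

Lemma coords_eval e : map (fun f => f e) (coords (length e)) = map sgn e.
Proof.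
induction e as [|b e IH]; simpl; auto.
rewrite map_map; f_equal; exact IH.
Qed.

Lemma coords_length n : length (coords n) = n.
Proof. induction n; simpl; rewrite ?length_map; auto. Qed.

Lemma coords_poly n : Forall (pos_poly n 1) (coords n).
Proof.
induction n as [|n IH]; simpl; constructor.
- clear IH; assert (L : length (true :: repeat false n) = S n) by (simpl; rewrite repeat_length; auto).
  apply pos_poly_chi in L.
  replace (count_true (true :: repeat false n)) with 1%nat in L
    by (rewrite count_true_cons, count_true_repeat_false; auto).
  revert L; apply pos_poly_ext; intros [|b e] He; [discriminate|].
  simpl in *; injection He as <-; replace (chi _ e) with 1; [ring|].
  induction e as [|b' e IHe]; simpl; auto; rewrite <- IHe; ring.
- apply Forall_map, (Forall_impl _ (P := pos_poly n 1)); [|exact IH].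
  intros f (l & Hl & Hf).
  exists (map (fun ca => (fst ca, false :: snd ca)) l); split.
  + intros ca Hca; apply in_map_iff in Hca as (x & <- & Hx); simpl.
    destruct (Hl x Hx) as (H1 & H2 & H3); repeat split; auto.
  + intros [|b e] He; [discriminate|]; simpl; rewrite Hf by (simpl in He; lia).
    rewrite rsum_map; apply rsum_ext; intros; simpl; ring.
Qed.

Lemma iid_rsum_fun {A B} (D : Dist A) n (f : B -> list A -> R) l :
  iid D n (fun y => rsum (fun b => f b y) l) = rsum (fun b => iid D n (f b)) l.
Proof.
induction l as [|b l IH]; unfold rsum in *; simpl.
- rewrite (iid_ext D n _ (fun _ => 0 * 0)) by (intros; ring).
  rewrite (iid_scal D n 0 (fun _ => 0)); ring.
- rewrite iid_plus, IH; reflexivity.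
Qed.

Lemma bern_mass e : ex (bern e) (fun _ => 1) = 1.
Proof. unfold ex, rsum, bern; simpl; field. Qed.

(** * Comparison of a shell with independent symbols *)

Section Shell.
Context (n t K : nat) (e : R) (Ee : e = 1 - 2 * INR t / INR n) (He : 0 < e <= 1)
  (HK : 4 * INR K <= INR n * (e * e)).

Let c : R := wsum (shell t) n (fun _ => 1).
Let eta : R := 2 * (INR K * INR K) / (INR n * (e * e)).

Lemma pos_poly_shell f : pos_poly n K f ->
  (1 - eta) * (c * iid (bern e) n f) <= wsum (shell t) n f <= c * iid (bern e) n f.
Proof.
intros (l & Hl & Hf).
rewrite (iid_ext _ _ _ _ Hf), (wsum_ext _ _ _ _ Hf).
rewrite iid_rsum_fun, wsum_rsum, <- rsum_scal, <- rsum_scal.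
split; apply rsum_le; intros ca Hca; destruct (Hl ca Hca) as (H1 & H2 & H3);
  destruct (shell_chi_bounds n t K e Ee He HK _ H2 H3) as [B1 B2]; fold c in B1, B2;
  rewrite iid_scal, wsum_scal.
- fold eta in B1; apply (Rmult_le_compat_l (fst ca)) in B1; auto; lra.
- apply (Rmult_le_compat_l (fst ca)) in B2; auto; lra.
Qed.

Lemma leaf_shell k z : pos_poly n k z -> (2 * k <= K)%nat ->
  wsum (shell t) n (fun x => leaf 0 (z x)) <= c * iid (bern e) n (fun x => leaf eta (z x)).
Proof.
intros Hz Hk.
assert (Hzz : pos_poly n K (fun x => z x * z x)).
{ apply pos_poly_weaken with (k + k)%nat; [lia|apply pos_poly_mult; assumption]. }
assert (Hz' : pos_poly n K z) by (apply pos_poly_weaken with (2 := Hz); lia).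
apply pos_poly_shell in Hzz, Hz'.
rewrite (wsum_ext _ _ _ (fun x => z x * z x + (- (2) * z x + 1)))
  by (intros; unfold leaf; ring).
rewrite (iid_ext _ _ _ (fun x => z x * z x + (- (2 * (1 - eta)) * z x + 1)))
  by (intros; unfold leaf; ring).
rewrite !wsum_plus, !iid_plus, !wsum_scal, !iid_scal, iid_const by (apply bern_mass).
fold c; lra.
Qed.

Definition eval_all (fs : list (list bool -> R)) (x : list bool) : list R :=
  map (fun f => f x) fs.

Definition zipF (op : R -> R -> R) (fs gs : list (list bool -> R)) :
  list (list bool -> R) :=
  map (fun p x => op (fst p x) (snd p x)) (combine fs gs).

Lemma eval_zipF op fs gs x :
  eval_all (zipF op fs gs) x = zipw op (eval_all fs x) (eval_all gs x).
Proof.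
unfold eval_all, zipF; rewrite map_map; revert gs.
induction fs as [|f fs IH]; intros [|g gs]; simpl; auto; rewrite IH; reflexivity.
Qed.

Lemma zipF_poly op k k' fs gs :
  (forall f g, pos_poly n k f -> pos_poly n k g -> pos_poly n k' (fun x => op (f x) (g x))) ->
  Forall (pos_poly n k) fs -> Forall (pos_poly n k) gs ->
  Forall (pos_poly n k') (zipF op fs gs).
Proof.
intros H Hf Hg; unfold zipF; apply Forall_map, Forall_forall; intros [f g] Hfg.
rewrite Forall_forall in Hf, Hg; apply H; simpl.
- apply Hf, (in_combine_l _ _ _ _ Hfg).
- apply Hg, (in_combine_r _ _ _ _ Hfg).
Qed.

Lemma zipF_length op fs gs : length fs = length gs ->
  length (zipF op fs gs) = length fs.
Proof. intros H; unfold zipF; rewrite length_map, length_combine; lia. Qed.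

Lemma total_poly k fs : Forall (pos_poly n k) fs ->
  pos_poly n k (fun x => total (eval_all fs x)).
Proof.
induction 1 as [|f fs Hf H IH].
- apply (pos_poly_const n 0); lra.
- apply (pos_poly_plus n k _ _ Hf IH).
Qed.

(** The invariant [2 ^ S r * k <= K] survives because a product doubles the degree [k] and lowers
    [r] by one, while an average changes neither. One factor 2 is left at the leaf for the
    square. *)
Lemma cheb_shell r m : forall k fs mu, 0 < mu -> length fs = (2 ^ m)%nat ->
  Forall (pos_poly n k) fs -> (2 ^ S r * k <= K)%nat ->
  wsum (shell t) n (fun x => cheb 0 r m mu (eval_all fs x)) <=
  c * iid (bern e) n (fun x => cheb eta r m mu (eval_all fs x)).
Proof.
revert r m; apply (rm_ind (fun r m => forall k fs mu, 0 < mu -> length fs = (2 ^ m)%nat ->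
  Forall (pos_poly n k) fs -> (2 ^ S r * k <= K)%nat ->
  wsum (shell t) n (fun x => cheb 0 r m mu (eval_all fs x)) <=
  c * iid (bern e) n (fun x => cheb eta r m mu (eval_all fs x)))); unfold cheb.
- intros m k fs mu Hmu Lf Hf Hk; rewrite !rm_rec_rep.
  apply (leaf_shell k (fun x => total (eval_all fs x) / (2 ^ m * mu))); [|simpl in Hk; lia].
  apply (pos_poly_ext n k (fun x => / (2 ^ m * mu) * total (eval_all fs x))).
  + intros; unfold Rdiv; ring.
  + apply pos_poly_scal, total_poly; auto; left; apply Rinv_0_lt_compat.
    apply Rmult_lt_0_compat; auto; apply pow_lt; lra.
- intros r m H1 H2 k fs mu Hmu Lf Hf Hk; rewrite !rm_rec_full by assumption.
  assert (Hk2 : (2 * k <= K)%nat).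
  { assert (2 ^ 1 <= 2 ^ S r)%nat by (apply Nat.pow_le_mono_r; lia).
    simpl (2 ^ 1)%nat in *; nia. }
  unfold eval_all.
  rewrite (wsum_ext _ _ _ (fun x => rsum (fun f => leaf 0 (f x / mu)) fs))
    by (intros; apply (rsum_map (fun z => leaf 0 (z / mu)))).
  rewrite (iid_ext _ _ _ (fun x => rsum (fun f => leaf eta (f x / mu)) fs))
    by (intros; apply (rsum_map (fun z => leaf eta (z / mu)))).
  rewrite wsum_rsum, iid_rsum_fun, <- rsum_scal; apply rsum_le; intros f Hin.
  apply (leaf_shell k (fun x => f x / mu)); auto.
  apply (pos_poly_ext n k (fun x => / mu * f x)); [intros; unfold Rdiv; ring|].
  apply pos_poly_scal; [left; apply Rinv_0_lt_compat; auto|].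
  rewrite Forall_forall in Hf; auto.
- intros r m H IHv IHu k fs mu Hmu Lf Hf Hk; rewrite !rm_rec_step by assumption.
  cbv zeta; rewrite wsum_plus, iid_plus, Rmult_plus_distr_l.
  assert (Lf1 : length (firstn (2 ^ m) fs) = (2 ^ m)%nat)
    by (rewrite length_firstn, Lf; simpl; lia).
  assert (Lf2 : length (skipn (2 ^ m) fs) = (2 ^ m)%nat)
    by (rewrite length_skipn, Lf; simpl; lia).
  assert (Hf' : Forall (pos_poly n k) (firstn (2 ^ m) fs) /\
                Forall (pos_poly n k) (skipn (2 ^ m) fs)).
  { apply Forall_app; rewrite firstn_skipn; exact Hf. }
  destruct Hf' as [Hf1 Hf2].
  assert (E : forall op x,
    zipw op (firstn (2 ^ m) (eval_all fs x)) (skipn (2 ^ m) (eval_all fs x)) =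
    eval_all (zipF op (firstn (2 ^ m) fs) (skipn (2 ^ m) fs)) x).
  { intros op x; rewrite eval_zipF; unfold eval_all; rewrite firstn_map, skipn_map.
    reflexivity. }
  apply Rplus_le_compat.
  + rewrite (wsum_ext _ _ _ _ (fun x _ => f_equal _ (E Rmult x))).
    rewrite (iid_ext _ _ _ _ (fun x _ => f_equal _ (E Rmult x))).
    apply (IHv (k + k)%nat); [nra| | |simpl in *; lia].
    * rewrite zipF_length; congruence.
    * apply zipF_poly with (k := k); auto; intros; apply pos_poly_mult; assumption.
  + rewrite (wsum_ext _ _ _ _ (fun x _ => f_equal _ (E (fun a b => (a + b) / 2) x))).
    rewrite (iid_ext _ _ _ _ (fun x _ => f_equal _ (E (fun a b => (a + b) / 2) x))).
    apply (IHu k); auto.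
    * rewrite zipF_length; congruence.
    * apply zipF_poly with (k := k); auto; intros f g Pf Pg.
      apply (pos_poly_ext n k (fun x => / 2 * (f x + g x))); [intros; field|].
      apply pos_poly_scal; [lra|apply pos_poly_plus; assumption].
Qed.

End Shell.

(** * From shells to balls *)

Lemma shell_nonneg t k : 0 <= shell t k.
Proof. unfold shell; destruct Nat.eq_dec; lra. Qed.

Lemma wsum_le h n f g : (forall k, 0 <= h k) ->
  (forall e, length e = n -> f e <= g e) -> wsum h n f <= wsum h n g.
Proof.
intros Hh H; apply csum_le; intros e He; apply Rmult_le_compat_l; auto.
Qed.

(** Here [K = 2 ^ S r], as the received symbols have degree 1, and [/ (e * e) - 1] is the relative
    variance of a sign of mean [e]. *)
Lemma shell_fail r m c t e : rm_word r m c ->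
  e = 1 - 2 * INR t / 2 ^ m -> 0 < e <= 1 -> 4 * 2 ^ S r <= 2 ^ m * (e * e) ->
  wsum (shell t) (2 ^ m) (fun x => 1 - ex (psi r m (c ** map sgn x)) (eqi c)) <=
  wsum (shell t) (2 ^ m) (fun _ => 1) *
    (cheb_mean r m (/ (e * e) - 1) +
     2 * (2 * (2 ^ S r * 2 ^ S r) / (2 ^ m * (e * e))) * leaves r m).
Proof.
intros Hc Ee He HK.
rewrite <- (INR_pow2 m) in Ee, HK; rewrite <- (INR_pow2 (S r)) in HK.
destruct (rm_word_pm _ _ _ Hc) as [Lc Pc].
apply Rle_trans with (wsum (shell t) (2 ^ m)
  (fun x => cheb 0 r m e (eval_all (coords (2 ^ m)) x))).
- apply wsum_le; [apply shell_nonneg|]; intros x Hx.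
  assert (Lx : length (map sgn x) = (2 ^ m)%nat) by (rewrite length_map; auto).
  assert (Ex : eval_all (coords (2 ^ m)) x = map sgn x)
    by (rewrite <- Hx; apply coords_eval).
  rewrite Ex; apply Rle_trans with (2 := psi_fail_cheb r m e _ ltac:(lra) Lx).
  apply Rplus_le_compat_l, Ropp_le_contravar.
  apply Rle_trans with (1 := psi_prob_translate r m c _ (repeat 1 (2 ^ m)) Hc Lx).
  rewrite (had_comm c (repeat _ _)), had_ones by assumption; apply Rle_refl.
- apply Rle_trans with (1 := cheb_shell _ t _ e Ee He HK r m 1 (coords (2 ^ m)) e
    ltac:(lra) (coords_length _) (coords_poly _) ltac:(lia)).
  apply Req_le; f_equal; rewrite !INR_pow2.
  set (eta := 2 * (2 ^ S r * 2 ^ S r) / (2 ^ m * (e * e))).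
  rewrite (iid_ext _ _ _ (fun x => cheb eta r m e (map sgn x)))
    by (intros x Hx; rewrite <- Hx; unfold eval_all; rewrite coords_eval; reflexivity).
  rewrite iid_map; apply iid_cheb; [lra| | |]; rewrite ex_dbind;
    unfold ex, rsum, bern, dret, sgn; simpl; field; lra.
Qed.

Lemma rsum_shell (h : nat -> R) k N : (k < N)%nat ->
  rsum (fun t => h t * shell t k) (seq 0 N) = h k.
Proof.
intros Hk.
replace (seq 0 N) with (seq 0 k ++ k :: seq (S k) (N - S k)).
2: { replace N with (k + S (N - S k))%nat at 2 by lia; rewrite seq_app; reflexivity. }
assert (Z : forall l, ~ In k l -> rsum (fun t => h t * shell t k) l = 0).
{ intros l Hl; rewrite (rsum_ext _ (fun _ => 0)); [apply rsum_zero|].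
  intros t Ht; unfold shell; destruct Nat.eq_dec as [->|]; [contradiction|ring]. }
rewrite rsum_app, Z by (rewrite in_seq; lia).
change (0 + (h k * shell k k + rsum (fun t => h t * shell t k) (seq (S k) (N - S k))) = h k).
rewrite Z by (rewrite in_seq; lia).
unfold shell; destruct Nat.eq_dec; [ring|congruence].
Qed.

Lemma wsum_shells h n f :
  wsum h n f = rsum (fun t => h t * wsum (shell t) n f) (seq 0 (S n)).
Proof.
unfold wsum, csum.
rewrite (rsum_ext _ (fun e => rsum (fun t => h t * (shell t (count_true e) * f e)) (seq 0 (S n)))).
- rewrite rsum_swap; apply rsum_ext; intros t _; rewrite rsum_scal; reflexivity.
- intros e He; apply in_cube in He; pose proof (count_true_le e).
  rewrite (rsum_ext _ (fun t => f e * (h t * shell t (count_true e)))) by (intros; ring).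
  rewrite rsum_scal, rsum_shell by lia; ring.
Qed.

(** The ball is a disjoint union of shells, so its failure fraction is a weighted mean of theirs. *)
Lemma fail_frac_bound r m c w B : rm_word r m c -> 0 <= B ->
  (forall t, INR t <= w ->
    wsum (shell t) (2 ^ m) (fun x => 1 - ex (psi r m (c ** map sgn x)) (eqi c)) <=
    wsum (shell t) (2 ^ m) (fun _ => 1) * B) ->
  0 <= fail_frac r m c w <= B.
Proof.
intros Hc HB H; rewrite fail_frac_eq.
destruct (rm_word_pm _ _ _ Hc) as [Lc Pc].
set (f x := 1 - ex (psi r m (c ** map sgn x)) (eqi c)).
rewrite (csum_ext _ (fun e => in_ball w (count_true e)) (fun e => in_ball w (count_true e) * 1))
  by (intros; ring).
change (0 <= wsum (in_ball w) (2 ^ m) f / wsum (in_ball w) (2 ^ m) (fun _ => 1) <= B).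
assert (Hb : forall k, 0 <= in_ball w k) by (intros; unfold in_ball; destruct Rle_dec; lra).
assert (H1 : wsum (in_ball w) (2 ^ m) f <= wsum (in_ball w) (2 ^ m) (fun _ => 1) * B).
{ rewrite (wsum_shells _ _ f), (wsum_shells _ _ (fun _ => 1)), Rmult_comm, <- rsum_scal.
  apply rsum_le; intros t _; unfold in_ball; destruct Rle_dec as [Ht|]; [|lra].
  specialize (H t Ht); fold f in H; lra. }
assert (H0 : 0 <= wsum (in_ball w) (2 ^ m) f).
{ rewrite <- (Rmult_0_l (wsum (in_ball w) (2 ^ m) f)), <- wsum_scal.
  apply wsum_le; auto; intros x Hx; unfold f.
  pose proof (psi_prob_01 r m (c ** map sgn x) c
    ltac:(rewrite zipw_length; rewrite ?length_map; congruence)); lra. }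
assert (H2 : 0 <= wsum (in_ball w) (2 ^ m) (fun _ => 1)) by (apply wsum_nonneg; auto; intros; lra).
set (b := wsum (in_ball w) (2 ^ m) (fun _ => 1)) in *.
destruct (Rle_lt_or_eq_dec _ _ H2) as [Hp|E].
- pose proof (Rinv_0_lt_compat _ Hp).
  split; [apply Rmult_le_pos; lra|].
  apply Rmult_le_reg_r with b; auto; field_simplify; lra.
(* The ball is empty: the numerator vanishes too, and the quotient is 0. *)
- rewrite <- E in *; replace (wsum (in_ball w) (2 ^ m) f) with 0 by lra.
  unfold Rdiv; rewrite Rmult_0_l; lra.
Qed.

(** * Asymptotics *)

Lemma leaves_bound r m : leaves r m <= 2 ^ r * (INR m + 1) ^ r.
Proof.
revert r m; apply (rm_ind (fun r m => leaves r m <= 2 ^ r * (INR m + 1) ^ r));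
  unfold leaves.
- intros m; rewrite rm_rec_rep; simpl; lra.
- intros r m H1 H2; rewrite rm_rec_full by assumption.
  assert (2 ^ m <= 2 ^ r) by (apply Rle_pow; lra || lia).
  assert (1 <= (INR m + 1) ^ r) by (apply pow_R1_Rle; pose proof (pos_INR m); lra).
  assert (0 < 2 ^ r) by (apply pow_lt; lra); nra.
- intros r m H IHv IHu; rewrite rm_rec_step, S_INR by assumption.
  apply Rle_trans with (2 ^ r * (INR m + 1) ^ r + 2 ^ S r * (INR m + 1) ^ S r); [lra|].
  pose proof (pos_INR m); simpl pow.
  assert ((INR m + 1) ^ r <= (INR m + 1 + 1) ^ r) by (apply pow_incr; lra).
  assert (0 < 2 ^ r) by (apply pow_lt; lra).
  assert (0 < (INR m + 1) ^ r) by (apply pow_lt; lra).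
  set (p := (INR m + 1) ^ r) in *; set (q := (INR m + 1 + 1) ^ r) in *.
  replace (2 ^ r * p + 2 * 2 ^ r * ((INR m + 1) * p)) with
    (2 ^ r * (p * (2 * INR m + 3))) by ring.
  replace (2 * 2 ^ r * ((INR m + 1 + 1) * q)) with
    (2 ^ r * (q * (2 * INR m + 4))) by ring.
  apply Rmult_le_compat_l; [lra|nra].
Qed.

Lemma pow_between x i j : 0 <= x -> (1 <= i <= j)%nat -> x ^ i <= x + x ^ j.
Proof.
intros Hx Hij; destruct (Rle_lt_dec x 1) as [H1|H1].
- assert (x ^ i <= x).
  { destruct i as [|i]; [lia|]; simpl.
    assert (x ^ i <= 1) by (rewrite <- (pow1 i); apply pow_incr; lra); nra. }
  assert (0 <= x ^ j) by (apply pow_le; auto); lra.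
- assert (x ^ i <= x ^ j) by (apply Rle_pow; [lra|lia]); lra.
Qed.

Lemma sqr_plus_pow x j : 0 <= x -> (x * x + 2 * x) ^ j <= 3 ^ j * (x ^ j + x ^ (2 * j)).
Proof.
intros Hx; rewrite pow_mult; simpl (x ^ 2); rewrite Rmult_1_r.
assert (0 <= x ^ j) by (apply pow_le; auto).
assert (0 <= (x * x) ^ j) by (apply pow_le; nra).
assert (0 < 3 ^ j) by (apply pow_lt; lra).
destruct (Rle_lt_dec x 1).
- apply Rle_trans with ((3 * x) ^ j); [apply pow_incr; nra|rewrite Rpow_mult_distr; nra].
- apply Rle_trans with ((3 * (x * x)) ^ j);
    [apply pow_incr; nra|rewrite Rpow_mult_distr; nra].
Qed.

Lemma half_pow x j : 0 <= x -> (1 <= j)%nat -> 2 * (x / 2) ^ j <= x ^ j.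
Proof.
intros Hx Hj; destruct j as [|j]; [lia|]; simpl.
assert ((x / 2) ^ j <= x ^ j) by (apply pow_incr; lra).
assert (0 <= (x / 2) ^ j) by (apply pow_le; lra); nra.
Qed.

(* Each averaging before the last product at least halves the contribution to
   [x ^ 2^r], hence the coefficient independent of [m]; the number of leaves only
   shows in the terms of lower degree. *)
Lemma cheb_mean_bound r : exists a b, 0 <= a /\ 0 <= b /\ (r = 0%nat -> b = 0) /\
  forall m x, 0 <= x -> 2 ^ m * cheb_mean r m x <=
    a * x ^ (2 ^ r) + b * (INR m + 1) ^ r * (x + x ^ (2 ^ r - 1)).
Proof.
induction r as [|r (a & b & Ha & Hb & Hb0 & IH)].
(* At [r = 0] the power [x ^ (2 ^ r - 1)] is the constant 1, which after the product step could not
   be bounded by a multiple of [x + x ^ (2 * N - 1)] near [x = 0]; hence the clause forcing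
   [b = 0]. *)
- exists 1, 0; repeat split; try lra; intros m x Hx.
  unfold cheb_mean; rewrite rm_rec_rep; simpl pow.
  assert (0 < 2 ^ m) by (apply pow_lt; lra).
  replace (2 ^ m * (x / 2 ^ m)) with x by (field; lra); lra.
- set (N := (2 ^ r)%nat); assert (HN : (1 <= N)%nat).
  { unfold N; pose proof (Nat.pow_nonzero 2 r); lia. }
  change (2 ^ S r)%nat with (2 * N)%nat.
  assert (H3 : forall j, 1 <= 3 ^ j) by (intros; apply pow_R1_Rle; lra).
  (* [A] solves [2 * (a * 3 ^ N) + A / 2 = A]: the product branch feeds in the first summand, the
     averaging branch returns half of [A]. *)
  pose (A := 4 * (a * 3 ^ N)).
  (* The summands pay for the full-space leaves, for the part of [a * (x * x + 2 * x) ^ N] below top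
     degree, and for the lower terms of the inductive bound. *)
  pose (B := 4 ^ S r + 2 * (a * 3 ^ N) + 2 * b * (12 * 3 ^ N)).
  assert (H3N := H3 N).
  assert (H4 : 1 <= 4 ^ S r) by (apply pow_R1_Rle; lra).
  assert (HA : 0 <= A) by (unfold A; nra).
  assert (Hb12 : 0 <= 2 * b * (12 * 3 ^ N)) by nra.
  assert (Ha3 : 0 <= a * 3 ^ N) by nra.
  assert (HB : 0 <= B) by (unfold B; lra).
  exists A, B; repeat split; auto; [discriminate|].
  assert (Hlow : forall m x, 0 <= x ->
    2 * (2 ^ m * cheb_mean r m (x * x + 2 * x)) <=
    2 * (a * 3 ^ N) * x ^ (2 * N) +
    (B - 4 ^ S r) * (INR m + 1) ^ r * (x + x ^ (2 * N - 1))).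
  { intros m x Hx.
    assert (Hx2 : 0 <= x * x + 2 * x) by nra.
    specialize (IH m _ Hx2); fold N in IH.
    set (P := x + x ^ (2 * N - 1)).
    assert (HP : forall i, (1 <= i <= 2 * N - 1)%nat -> x ^ i <= P)
      by (intros; apply pow_between; auto; lia).
    assert (HP0 : 0 <= P).
    { unfold P; assert (0 <= x ^ (2 * N - 1)) by (apply pow_le; auto); lra. }
    pose proof (sqr_plus_pow x N Hx) as S1.
    assert (E1 : a * (x * x + 2 * x) ^ N <= a * 3 ^ N * (P + x ^ (2 * N))).
    { rewrite Rmult_assoc; apply Rmult_le_compat_l; auto.
      apply Rle_trans with (1 := S1); apply Rmult_le_compat_l; [lra|].
      pose proof (HP N ltac:(lia)); lra. }
    assert (Hm : 1 <= (INR m + 1) ^ r)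
      by (apply pow_R1_Rle; pose proof (pos_INR m); lra).
    set (M := (INR m + 1) ^ r) in *.
    destruct (Nat.eq_dec N 1) as [EN|NN].
    - assert (Er : r = 0%nat).
      { destruct r as [|r']; auto; unfold N in EN; simpl in EN.
        pose proof (Nat.pow_nonzero 2 r'); lia. }
      assert (M1 : M = 1) by (unfold M; rewrite Er; reflexivity).
      unfold B; rewrite (Hb0 Er) in IH |- *; rewrite M1 in IH |- *; lra.
    - assert (E2 : x * x + 2 * x + (x * x + 2 * x) ^ (N - 1) <= 12 * 3 ^ N * P).
      { pose proof (sqr_plus_pow x (N - 1) Hx) as S2.
        pose proof (HP 1%nat ltac:(lia)) as P1; pose proof (HP 2%nat ltac:(lia)) as P2.
        pose proof (HP (N - 1)%nat ltac:(lia)) as P3.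
        pose proof (HP (2 * (N - 1))%nat ltac:(lia)) as P4.
        simpl in P1, P2.
        assert (3 ^ (N - 1) <= 3 ^ N) by (apply Rle_pow; [lra|lia]).
        assert (3 ^ (N - 1) * (x ^ (N - 1) + x ^ (2 * (N - 1))) <= 3 ^ N * (2 * P)).
        { apply Rmult_le_compat; try lra.
          - pose proof (H3 (N - 1)%nat); lra.
          - apply Rplus_le_le_0_compat; apply pow_le; auto. }
        nra. }
      assert (E3 : b * M * (x * x + 2 * x + (x * x + 2 * x) ^ (N - 1)) <=
        b * M * (12 * 3 ^ N * P)) by (apply Rmult_le_compat_l; [nra|auto]).
      assert (0 <= a * 3 ^ N * P * (M - 1)) by (apply Rmult_le_pos; nra).
      unfold B; nra. }
  assert (Hfull : forall m x, 0 <= x -> (m <= S r)%nat ->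
    2 ^ m * cheb_mean (S r) m x <=
    A * x ^ (2 * N) + B * (INR m + 1) ^ S r * (x + x ^ (2 * N - 1))).
  { intros m x Hx Hm; unfold cheb_mean; rewrite rm_rec_full by lia.
    assert (0 <= A * x ^ (2 * N)) by (apply Rmult_le_pos, pow_le; auto).
    assert (0 <= x ^ (2 * N - 1)) by (apply pow_le; auto).
    assert (1 <= (INR m + 1) ^ S r)
      by (apply pow_R1_Rle; pose proof (pos_INR m); lra).
    replace (2 ^ m * (2 ^ m * x)) with (4 ^ m * x)
      by (replace 4 with (2 * 2) by ring; rewrite Rpow_mult_distr; ring).
    assert (4 ^ m <= 4 ^ S r) by (apply Rle_pow; lra || lia).
    assert (4 ^ S r <= B) by (unfold B; lra).
    assert (B * 1 <= B * (INR m + 1) ^ S r) by (apply Rmult_le_compat_l; lra).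
    assert (4 ^ m * x <= B * (INR m + 1) ^ S r * x) by (apply Rmult_le_compat_r; lra).
    assert (0 <= B * (INR m + 1) ^ S r * x ^ (2 * N - 1)) by (apply Rmult_le_pos; lra).
    lra. }
  intros m; induction m as [|m IHm]; intros x Hx; [apply Hfull; auto; lia|].
  destruct (Nat.le_gt_cases m r) as [Hm|Hm]; [apply Hfull; auto; lia|].
  unfold cheb_mean; rewrite rm_rec_step by assumption; fold cheb_mean.
  specialize (Hlow m x Hx); specialize (IHm (x / 2) ltac:(lra)).
  set (P := x + x ^ (2 * N - 1)) in *.
  assert (HP0 : 0 <= P).
  { unfold P; assert (0 <= x ^ (2 * N - 1)) by (apply pow_le; auto); lra. }
  pose proof (half_pow x (2 * N - 1) Hx ltac:(lia)) as Hh.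
  (* The exponent is at least 2, so a net factor [1 / 2] is gained here; the lower terms in [E2]
     only break even and therefore accumulate over [m]. *)
  assert (E1 : 2 * (x / 2) ^ (2 * N) <= x ^ (2 * N) / 2).
  { replace (2 * N)%nat with (S (2 * N - 1)) by lia.
    rewrite <- !tech_pow_Rmult; apply (Rmult_le_compat_l (x / 2)) in Hh; lra. }
  assert (E2 : 2 * (x / 2 + (x / 2) ^ (2 * N - 1)) <= P) by (unfold P; lra).
  rewrite S_INR; pose proof (pos_INR m).
  assert (Hpr : (INR m + 1) ^ r <= (INR m + 1 + 1) ^ r) by (apply pow_incr; lra).
  change ((INR m + 1) ^ S r) with ((INR m + 1) * (INR m + 1) ^ r) in IHm.
  change ((INR m + 1 + 1) ^ S r) with ((INR m + 1 + 1) * (INR m + 1 + 1) ^ r).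
  change (2 ^ S m) with (2 * 2 ^ m).
  assert (Hp0 : 0 < (INR m + 1) ^ r) by (apply pow_lt; lra).
  set (p := (INR m + 1) ^ r) in *; set (q := (INR m + 1 + 1) ^ r) in *.
  assert (F1 : A * (2 * (x / 2) ^ (2 * N)) <= A * (x ^ (2 * N) / 2))
    by (apply Rmult_le_compat_l; auto).
  assert (F2 : B * ((INR m + 1) * p) * (2 * (x / 2 + (x / 2) ^ (2 * N - 1))) <=
    B * ((INR m + 1) * p) * P).
  { apply Rmult_le_compat_l; auto; repeat apply Rmult_le_pos; lra. }
  assert (F3 : (B - 4 ^ S r) * p * P <= B * p * P).
  { apply Rmult_le_compat_r; auto; apply Rmult_le_compat_r; [lra|].
    assert (0 < 4 ^ S r) by (apply pow_lt; lra); lra. }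
  assert (F4 : B * P * (p * (INR m + 1 + 1)) <= B * P * (q * (INR m + 1 + 1))).
  { apply Rmult_le_compat_l; [apply Rmult_le_pos; auto|].
    apply Rmult_le_compat_r; lra. }
  unfold A in *; lra.
Qed.

Lemma poly_le_exp q : exists C, 0 < C /\ forall m, (INR m + 1) ^ q <= C * 2 ^ m.
Proof.
destruct (Nat.eq_dec q 0) as [->|Hq].
{ exists 1; split; [lra|]; intros m; rewrite Rmult_1_l; apply (pow_R1_Rle 2 m); lra. }
assert (0 < INR q) by (apply lt_0_INR; lia).
exists (INR q ^ q); split; [apply pow_lt; auto|]; intros m.
(* Because [m + 1 <= q * (m / q + 1)] and [m / q + 1 <= 2 ^ (m / q)]. *)
assert (H1 : INR m + 1 <= INR q * 2 ^ (m / q)).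
{ rewrite <- S_INR, <- INR_pow2, <- mult_INR; apply le_INR.
  pose proof (Nat.div_mod m q Hq); pose proof (Nat.mod_upper_bound m q Hq).
  pose proof (Nat.pow_gt_lin_r 2 (m / q) ltac:(lia)); nia. }
apply Rle_trans with ((INR q * 2 ^ (m / q)) ^ q).
- apply pow_incr; split; auto; pose proof (pos_INR m); lra.
- rewrite Rpow_mult_distr; apply Rmult_le_compat_l; [apply pow_le; lra|].
  rewrite <- pow_mult; apply Rle_pow; [lra|].
  rewrite Nat.mul_comm; apply Nat.Div0.mul_div_le.
Qed.

Lemma INR_eventually A : exists N, forall m, (N <= m)%nat -> A < INR m.
Proof.
destruct (INR_unbounded A) as [N HN]; exists N; intros m Hm.
apply Rlt_le_trans with (1 := HN); apply le_INR; assumption.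
Qed.

(** One extra degree in [poly_le_exp] beats the constant [C]. *)
Lemma poly_lt_exp_eventually q C : exists N, forall m, (N <= m)%nat ->
  C * (INR m + 1) ^ q <= 2 ^ m.
Proof.
destruct (poly_le_exp (S q)) as (D & HD & H).
destruct (INR_eventually (Rabs C * D)) as [N HN]; exists N; intros m Hm.
specialize (H m); specialize (HN m Hm); simpl pow in H.
assert (0 < (INR m + 1) ^ q) by (apply pow_lt; pose proof (pos_INR m); lra).
set (p := (INR m + 1) ^ q) in *; pose proof (Rle_abs C); pose proof (Rabs_pos C).
apply Rmult_le_reg_l with D; auto.
apply Rle_trans with (2 := H).
assert (C * p <= Rabs C * p) by nra.
assert (D * (C * p) <= D * (Rabs C * p)) by nra.
nra.
Qed.

Lemma eps_r_pow r m : (1 <= r)%nat -> (r < m)%nat ->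
  0 < eps_r r m /\
  eps_r r m ^ (2 ^ (r + 1)) = 2 * INR r * ln (INR m) / 2 ^ (m - r).
Proof.
intros Hr Hm.
assert (H1 : 1 <= INR r) by (apply (le_INR 1); lia).
assert (H2 : 0 < ln (INR m)).
{ rewrite <- ln_1; apply ln_increasing; [lra|apply (lt_INR 1); lia]. }
set (a := 2 * INR r * ln (INR m) / 2 ^ (m - r)).
assert (Ha : 0 < a).
{ unfold a; apply Rdiv_lt_0_compat; [nra|apply pow_lt; lra]. }
assert (He : 0 < eps_r r m) by (apply exp_pos).
split; auto.
rewrite <- Rpower_pow by assumption; unfold eps_r; fold a.
rewrite Rpower_mult.
replace (1 / 2 ^ (r + 1) * INR (2 ^ (r + 1))) with 1; [apply Rpower_1; auto|].
rewrite pow_INR; replace (INR 2) with 2 by (simpl; lra).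
field; apply pow_nonzero; lra.
Qed.

Lemma Rle_pow_inv x y j : 0 <= x -> 0 <= y -> (1 <= j)%nat -> x ^ j <= y ^ j -> x <= y.
Proof.
intros Hx Hy Hj H; apply Rnot_lt_le; intros Hlt.
assert (y ^ j < x ^ j).
{ destruct j as [|j]; [lia|]; clear Hj H; induction j as [|j IH]; [simpl; lra|].
  change (y * y ^ S j < x * x ^ S j).
  assert (0 <= y ^ S j) by (apply pow_le; auto); nra. }
lra.
Qed.

(** The exponent in [eps_r] makes [X ^ (2 ^ r)] equal to [2 ^ m / (2 ^ r * 2 r * ln m)]. So [X]
    outgrows every power of [m + 1], while [X * X <= X ^ (2 ^ r) <= 2 ^ m]. *)
Lemma eps_r_eventually r : (1 <= r)%nat -> exists N, forall m, (N <= m)%nat ->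
  let X := / (eps_r r m * eps_r r m) in
  0 < eps_r r m /\ 1 <= ln (INR m) /\ 1 <= X /\ (INR m + 1) ^ r <= X /\
  X ^ (2 ^ r) <= 2 ^ m / ln (INR m) /\ 4 * 2 ^ S r * X <= 2 ^ m.
Proof.
intros Hr.
destruct (poly_lt_exp_eventually (r * 2 ^ r + 1) (2 ^ r * (2 * INR r))) as [N1 H1].
(* [exp 1] gives [ln m >= 1]; the other term makes [4 * 2 ^ S r <= X] through [m + 1 <= X]. *)
destruct (INR_eventually (exp 1 + 4 * 2 ^ S r)) as [N2 H2].
exists (N1 + N2 + r + 1)%nat; intros m Hm X.
specialize (H1 m ltac:(lia)); specialize (H2 m ltac:(lia)).
destruct (eps_r_pow r m Hr ltac:(lia)) as [He Hp].
set (e := eps_r r m) in *.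
assert (Hr1 : 1 <= INR r) by (apply (le_INR 1); lia).
assert (Hexp := exp_pos 1).
assert (Hpow2 : 0 < 2 ^ S r) by (apply pow_lt; lra).
assert (Hln : 1 <= ln (INR m)).
{ rewrite <- (ln_exp 1); left; apply ln_increasing; lra. }
assert (Hlnm : ln (INR m) <= INR m + 1).
{ pose proof (exp_ineq1_le (ln (INR m))) as H; rewrite exp_ln in H by lra; lra. }
assert (HX : 0 < X) by (unfold X; apply Rinv_0_lt_compat; nra).
set (L := ln (INR m)) in *.
assert (H2r : 0 < 2 ^ r) by (apply pow_lt; lra).
assert (H2m : 0 < 2 ^ m) by (apply pow_lt; lra).
assert (Hmr : 2 ^ (m - r) = 2 ^ m / 2 ^ r).
{ replace (2 ^ m) with (2 ^ (m - r + r)) by (f_equal; lia).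
  rewrite pow_add; field; lra. }
assert (HXp : X ^ (2 ^ r) = 2 ^ m / (2 ^ r * (2 * INR r) * L)).
{ unfold X; rewrite pow_inv.
  replace (e * e) with (e ^ 2) by ring; rewrite <- pow_mult.
  replace (2 * 2 ^ r)%nat with (2 ^ (r + 1))%nat by (rewrite Nat.add_1_r; reflexivity).
  rewrite Hp, Hmr; field; repeat split; nra. }
assert (Hm1 : 1 <= INR m + 1) by (pose proof (pos_INR m); lra).
assert (H2r1 : 1 <= 2 ^ r) by (apply pow_R1_Rle; lra).
assert (HN : (1 <= 2 ^ r)%nat) by (pose proof (Nat.pow_nonzero 2 r); lia).
assert (Hc : 1 <= 2 ^ r * (2 * INR r)) by nra.
set (c := 2 ^ r * (2 * INR r)) in *.
assert (Hpoly : (INR m + 1) ^ r <= X).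
{ apply Rle_pow_inv with (2 ^ r)%nat; auto; [apply pow_le; lra|lra|].
  rewrite HXp, <- pow_mult.
  apply Rmult_le_reg_r with (c * L); [nra|].
  unfold Rdiv; rewrite Rmult_assoc, Rinv_l, Rmult_1_r by nra.
  apply Rle_trans with (2 := H1); rewrite pow_add, pow_1.
  assert (0 < (INR m + 1) ^ (r * 2 ^ r)) by (apply pow_lt; lra).
  set (p := (INR m + 1) ^ (r * 2 ^ r)) in *.
  replace (p * (c * L)) with (c * p * L) by ring.
  rewrite <- Rmult_assoc; apply Rmult_le_compat_l; [nra|lra]. }
assert (Hm1r : INR m + 1 <= (INR m + 1) ^ r).
{ rewrite <- (pow_1 (INR m + 1)) at 1; apply Rle_pow; auto. }
assert (HXbound : X ^ (2 ^ r) <= 2 ^ m / L).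
{ rewrite HXp; apply Rmult_le_compat_l; [lra|].
  apply Rinv_le_contravar; nra. }
repeat split; auto; try lra.
assert (HXX : X * X <= 2 ^ m).
{ apply Rle_trans with (X ^ (2 ^ r)).
  - replace (X * X) with (X ^ (2 ^ 1)) by (simpl; ring).
    apply Rle_pow; [lra|apply Nat.pow_le_mono_r; lia].
  - apply Rle_trans with (1 := HXbound).
    apply Rmult_le_reg_r with L; [lra|].
    unfold Rdiv; rewrite Rmult_assoc, Rinv_l by lra; nra. }
apply Rle_trans with (2 := HXX); apply Rmult_le_compat_r; lra.
Qed.

Lemma fail_frac_eventually r : (1 <= r)%nat -> exists C N, 0 <= C /\
  forall m c, (N <= m)%nat -> rm_word r m c -> 0 < ln (INR m) /\
  0 <= fail_frac r m c (2 ^ m / 2 * (1 - eps_r r m)) <= C / ln (INR m).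
Proof.
intros Hr.
destruct (cheb_mean_bound r) as (a & b & Ha & Hb & _ & Hmean).
destruct (eps_r_eventually r Hr) as [N HN].
set (K := 2 ^ S r) in *.
exists (a + (2 * b + 4 * (K * K) * 2 ^ r)), N.
assert (HK : 0 < K) by (apply pow_lt; lra).
assert (H2r : 0 < 2 ^ r) by (apply pow_lt; lra).
assert (HKK : 0 <= 4 * (K * K) * 2 ^ r) by (clearbody K; repeat apply Rmult_le_pos; lra).
split; [lra|]; intros m c Hm Hc.
destruct (HN m Hm) as (He & Hln & HX1 & HXm & HXp & HXK); clear HN.
set (e := eps_r r m) in *; set (X := / (e * e)) in *; set (L := ln (INR m)) in *.
split; [lra|].
assert (H2m : 0 < 2 ^ m) by (apply pow_lt; lra).
set (M := (INR m + 1) ^ r) in *.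
assert (HM : 1 <= M) by (apply pow_R1_Rle; pose proof (pos_INR m); lra).
assert (HN2 : (1 <= 2 ^ r - 1)%nat).
{ pose proof (Nat.pow_le_mono_r 2 1 r ltac:(lia) Hr); simpl in *; lia. }
(* [Y] is one power of [X] short of the top, and [M <= X] fills that gap with the polynomial factor
   [M]. *)
set (Y := X ^ (2 ^ r - 1)).
assert (HY : X <= Y).
{ unfold Y; rewrite <- (pow_1 X) at 1; apply Rle_pow; auto. }
assert (HXY : X ^ (2 ^ r) = X * Y).
{ unfold Y; replace (2 ^ r)%nat with (S (2 ^ r - 1)) at 1 by lia; reflexivity. }
assert (HMY : M * Y <= 2 ^ m / L).
{ apply Rle_trans with (2 := HXp); rewrite HXY; apply Rmult_le_compat_r; lra. }
apply fail_frac_bound; auto.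
{ apply Rmult_le_pos; [lra|left; apply Rinv_0_lt_compat; lra]. }
intros t Ht.
set (e' := 1 - 2 * INR t / 2 ^ m).
(* Every shell in the ball has symbol mean at least [eps_r], and the bounds only improve as the mean
   grows. *)
assert (Hee : e <= e').
{ unfold e'; assert (2 * INR t / 2 ^ m <= 1 - e); [|lra].
  apply Rmult_le_reg_r with (2 ^ m); auto.
  unfold Rdiv; rewrite Rmult_assoc, Rinv_l by lra; lra. }
assert (He1 : e' <= 1).
{ unfold e'; assert (0 <= 2 * INR t / 2 ^ m); [|lra].
  apply Rmult_le_pos; [pose proof (pos_INR t); lra|left; apply Rinv_0_lt_compat; auto]. }
assert (Hsq : e * e <= e' * e') by nra.
assert (HXe : X * (e * e) = 1) by (unfold X; apply Rinv_l; nra).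
assert (HK' : 4 * K <= 2 ^ m * (e' * e')).
{ apply Rle_trans with (2 ^ m * (e * e)); [|apply Rmult_le_compat_l; lra].
  apply Rle_trans with (4 * K * X * (e * e)); [rewrite Rmult_assoc, HXe; lra|].
  apply Rmult_le_compat_r; nra. }
pose proof (shell_fail r m c t e' Hc eq_refl ltac:(lra) HK') as H.
apply Rle_trans with (1 := H); apply Rmult_le_compat_l.
{ apply wsum_nonneg; [apply shell_nonneg|intros; lra]. }
set (x := / (e' * e') - 1); fold K.
assert (HxX : / (e' * e') <= X) by (apply Rinv_le_contravar; nra).
assert (Hx0 : 0 <= x).
{ unfold x; assert (/ 1 <= / (e' * e')); [|rewrite Rinv_1 in *; lra].
  apply Rinv_le_contravar; nra. }
specialize (Hmean m x Hx0); fold M in Hmean.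
assert (G1 : x ^ (2 ^ r) <= X ^ (2 ^ r)) by (apply pow_incr; unfold x in *; lra).
assert (G2 : x ^ (2 ^ r - 1) <= Y) by (apply pow_incr; unfold x in *; lra).
assert (G3 : a * x ^ (2 ^ r) <= a * (2 ^ m / L)) by (apply Rmult_le_compat_l; lra).
assert (G4 : b * M * (x + x ^ (2 ^ r - 1)) <= b * (2 * (2 ^ m / L))).
{ rewrite Rmult_assoc; apply Rmult_le_compat_l; auto.
  apply Rle_trans with (M * (2 * Y)); [|lra].
  apply Rmult_le_compat_l; [lra|]; unfold x in *; lra. }
pose proof (leaves_bound r m) as Hl; fold M in Hl.
(* The total price of independence over all leaves is at most of order [X * M], hence of order
   [M * Y]. *)
assert (G5 : 2 ^ m * (2 * (2 * (K * K) / (2 ^ m * (e' * e'))) * leaves r m) <=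
  4 * (K * K) * 2 ^ r * (2 ^ m / L)).
{ replace (2 ^ m * (2 * (2 * (K * K) / (2 ^ m * (e' * e'))) * leaves r m)) with
    (4 * (K * K) * (/ (e' * e') * leaves r m)) by (field; split; nra).
  rewrite (Rmult_assoc (4 * (K * K)) (2 ^ r)); apply Rmult_le_compat_l; [nra|].
  assert (Hi : 0 <= / (e' * e')) by (unfold x in *; lra).
  apply Rle_trans with (/ (e' * e') * (2 ^ r * M)); [apply Rmult_le_compat_l; auto|].
  apply Rle_trans with (Y * (2 ^ r * M)); [apply Rmult_le_compat_r; nra|].
  replace (Y * (2 ^ r * M)) with (2 ^ r * (M * Y)) by ring.
  apply Rmult_le_compat_l; lra. }
apply Rmult_le_reg_l with (2 ^ m); auto.
rewrite Rmult_plus_distr_l.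
replace (2 ^ m * ((a + (2 * b + 4 * (K * K) * 2 ^ r)) / L)) with
  (a * (2 ^ m / L) + b * (2 * (2 ^ m / L)) + 4 * (K * K) * 2 ^ r * (2 ^ m / L))
  by (field; lra).
lra.
Qed.

Theorem theorem1 (r : nat) (hr : (1 <= r)%nat) :
  (exists C : R, forall m : nat, INR (psi_cost r m) <= C * 2 ^ m) /\
  (forall c : nat -> list R, (forall m, in_RM r m (c m)) ->
     Un_cv (fun m => fail_frac r m (c m) (2 ^ m / 2 * (1 - eps_r r m))) 0) /\
  (forall c : nat -> list R, (forall m, in_RM r m (c m)) ->
     ~ Un_cv (fun m => fail_frac r m (c m) (2 ^ m / 2)) 0).
Proof.
split; [apply psi_cost_linear|split; intros c Hc].
- destruct (fail_frac_eventually r hr) as (C & N & HC & H).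
  intros d Hd.
  destruct (INR_eventually (exp (C / d))) as [N' HN'].
  exists (N + N')%nat; intros m Hm; unfold Rdist; rewrite Rminus_0_r.
  destruct (H m (c m) ltac:(lia) (in_RM_rm_word _ _ _ (Hc m))) as (Hln & H0 & H1).
  specialize (HN' m ltac:(lia)).
  rewrite Rabs_right by lra; apply Rle_lt_trans with (1 := H1).
  assert (HL : C / d < ln (INR m)).
  { rewrite <- (ln_exp (C / d)); apply ln_increasing; auto; apply exp_pos. }
  apply (Rmult_lt_compat_r d) in HL; auto.
  unfold Rdiv in HL; rewrite Rmult_assoc, Rinv_l in HL by lra.
  apply Rmult_lt_reg_r with (ln (INR m)); auto.
  unfold Rdiv; rewrite Rmult_assoc, Rinv_l by lra; lra.
- intros Hcv; destruct (Hcv (1 / 2) ltac:(lra)) as [N HN].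
  destruct r as [|r]; [lia|].
  specialize (HN (S (N + r + 1)) ltac:(lia)).
  pose proof (fail_frac_half r (N + r + 1) (c (S (N + r + 1))) ltac:(lia)
    (in_RM_rm_word _ _ _ (Hc _))) as H.
  unfold Rdist in HN; rewrite Rminus_0_r in HN.
  pose proof (Rle_abs (fail_frac (S r) (S (N + r + 1)) (c (S (N + r + 1)))
    (2 ^ S (N + r + 1) / 2))); lra.
Qed.
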